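(* Let $n\ge1$ and let $G$ be a graph on $[n]$. The composition $R\mapsto \omega(\beta(\lambda(\widehat\rho(R))))$, applied to the regions of $\mathsf{Ish}(G)$ (identified with regions of $\mathsf{Ish}(n)$ as described below), is a bijection from the set of regions of $\mathsf{Ish}(G)$ onto the set of regions of $\mathsf{Shi}(G)$ (identified with regions of $\mathsf{Shi}(n)$ as described below) which preserves ceiling partitions (each region is sent to a region with the same ceiling partition) and dominance (a region is dominant if and only if its image is dominant).
   Context: Notation: $[n]=\{1,\dots,n\}$; permutations $\pi\in\mathfrak S_n$ in one-line notation $\pi_1\cdots\pi_n$. A graph $G$ on $[n]$ is a set of pairs $(i<j)$, $1\le i<j\le n$; $K_n$ is the complete graph. In $\mathbb R^n$ (coordinates $x_1,\dots,x_n$): $\mathsf{Shi}(G)=\{x_i-x_j=0:1\le i<j\le n\}\cup\{x_i-x_j=1:(i<j)\in G\}$ and $\mathsf{Ish}(G)=\{x_i-x_j=0:1\le i<j\le n\}\cup\{x_1-x_j=i:(i<j)\in G\}$; $\mathsf{Shi}(n)=\mathsf{Shi}(K_n)$, $\mathsf{Ish}(n)=\mathsf{Ish}(K_n)$. A region is a connected component of the complement of the union of the hyperplanes; it is dominant if $x_1>x_2>\dots>x_n$ on it. A hyperplane not through the origin is a ceiling of a region $R$ if it is the affine span of a facet of the closure of $R$ and does not separate $R$ from the origin. The ceiling partition of a region of $\mathsf{Shi}(G)$ (resp. $\mathsf{Ish}(G)$) is the set partition of $[n]$ generated by $i\sim j$ whenever $x_i-x_j=1$ (resp. $x_1-x_j=i$)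 is a ceiling. The arcs of a set partition are the pairs $(a<b)$ of consecutive elements of a common block. The position partition of a word $w_1\cdots w_k$ is the partition of $[k]$ with $i\sim j$ iff $w_i=w_j$. Identification: a region of $\mathsf{Shi}(G)$ (resp. $\mathsf{Ish}(G)$) is identified with the unique region of $\mathsf{Shi}(n)$ (resp. $\mathsf{Ish}(n)$) having the same Shi ceiling diagram (resp. Ish ceiling diagram, defined below); this identifies the regions of $\mathsf{Shi}(G)$ (resp. $\mathsf{Ish}(G)$) with the regions of $\mathsf{Shi}(n)$ (resp. $\mathsf{Ish}(n)$) whose ceiling partition has all arcs in $G$, preserving ceiling partitions and dominance. Here the Shi ceiling diagram of a region $R$ of $\mathsf{Shi}(G)$ is $(\pi,\Pi)$ with $x_{\pi_1}>\dots>x_{\pi_n}$ on $R$ and $\Pi$ the partition of $[n]$ generated by $a\sim b$ when $x_{\pi_a}-x_{\pi_b}=1$ is a ceiling; the Ish ceiling diagram of a region $R$ of $\mathsf{Ish}(G)$ is $(\pi,\epsilon)$ with $x_{\pi_1}>\dots>x_{\pi_n}$ on $R$ and $\epsilon_j=i$ if $x_1-x_{\pi_j}=i$ is a ceiling of $R$, $\epsilon_j=0$ otherwise. Parking functions and $\omega$: a parking function is a word $w\in[n]^n$ whose nondecreasing rearrangement $a_1\le\dots\le a_n$ has $a_i\le i$; $\mathsf{Park}_n$ is their set. For a region $R$ of $\mathsf{Shi}(n)$ with Shi ceiling diagram $(\pi,\Pi)$, let $w(R)_i$ be the smallest element of the block of $\Pi$ containing $\pi^{-1}(i)$. It is known that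 $R\mapsto w(R)$ is a bijection from regions of $\mathsf{Shi}(n)$ to $\mathsf{Park}_n$ and that the ceiling partition of $R$ equals the position partition of $w(R)$; $\omega$ is its inverse. Rook words and $\beta$: a rook word is $w=w_1\cdots w_n\in[n]^n$ such that every integer in $[1,w_1]$ occurs as a letter of $w$; $\mathsf{Rook}_n$ is their set. $\mathbb Z_{n+1}$ acts on $[n+1]^n$ by adding $1$ to each letter modulo $n+1$; each orbit contains exactly one parking function and exactly one rook word. $\beta:\mathsf{Rook}_n\to\mathsf{Park}_n$ sends a rook word to the parking function in its orbit. Rook placements: $\widehat B_n=\{(i,j):1\le i\le n,\ 1\le j\le n+i-1\}$ (column $i$, row $j$); rows $j\le n$ are below the bar, rows $j>n$ above the bar. A rook placement has no two rooks in a common row or column. For a region $R$ of $\mathsf{Ish}(n)$ with Ish ceiling diagram $(\pi,\epsilon)$, $\widehat\rho(R)$ has, for each $1\le i\le n$, one rook (Rook $i$) in column $i$: at $(i,\pi^{-1}(i))$ if $\epsilon_{\pi^{-1}(i)}=0$, and at $(i,n+\epsilon_{\pi^{-1}(i)})$ otherwise. A placement is called valid if it is inclusion-maximal and every row below the rook in column 1 contains a rook; $\widehat\rho(R)$ is valid. The map $\lambda$: for a valid rook placement on $\widehat B_n$ with Rook $i$ in row $r_i$ of column $i$, define $w_1,\dots,w_n$ inductively by $w_i=r_i$ if $r_i\le n$ and $w_i=w_{r_i-n}$ if $r_i>n$ (note $r_i-n<i$); equivalently, a rook at $(j,n+i)$ above the bar fires a laser down ending in the row of Rook $i$ if Rook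 $i$ is below the bar, or in the same row as the laser of Rook $i$ otherwise, and $w_j$ is the height of the rook or laser endpoint in column $j$. Then $\lambda(\widehat\rho)=w_1\cdots w_n$, which is a rook word. *)

(* Defs.v *)
From HB Require Import structures.
From mathcomp Require Import all_boot all_order all_algebra fingroup perm.
From mathcomp Require Import all_classical all_reals topology normedtype.

Set Implicit Arguments.
Unset Strict Implicit.
Unset Printing Implicit Defensive.

Import Order.TTheory GRing.Theory Num.Theory.
Import numFieldNormedType.Exports.

Local Open Scope classical_set_scope.
Local Open Scope ring_scope.

(* The dimension is n.+1.  An ordinal i : 'I_n.+1 stands for the element i.+1
   of [n.+1] = {1, ..., n.+1}, both as a coordinate and as a position in a word.
   Letters of words, rows of the board and the entries of epsilon are plain
   natural numbers and keep their usual values, counted from 1. *)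

Definition affine_span (R : realType) (n : nat) (A : set 'rV[R]_n.+1) :
    set 'rV[R]_n.+1 :=
  [set y | exists (k : nat) (p : 'I_k -> 'rV[R]_n.+1) (c : 'I_k -> R),
     [/\ forall i, A (p i), \sum_(i < k) c i = 1
       & y = \sum_(i < k) c i *: p i]].

Definition affine_dim (R : realType) (n : nat) (A : set 'rV[R]_n.+1)
    (d : nat) : Prop :=
  exists (x0 : 'rV[R]_n.+1) (V : {vspace 'rV[R]_n.+1}),
    affine_span A = [set x | x - x0 \in V] /\ \dim V = d.

Definition is_face (R : realType) (n : nat) (P F : set 'rV[R]_n.+1) : Prop :=
  exists (u : 'cV[R]_n.+1) (c : R),
    (forall x, P x -> (x *m u) 0 0 <= c) /\
    F = P `&` [set x | (x *m u) 0 0 = c].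

Definition is_facet (R : realType) (n : nat) (P F : set 'rV[R]_n.+1) : Prop :=
  is_face P F /\ exists d : nat, affine_dim F d /\ affine_dim P d.+1.

(* The inequalities are normalised by replacing (u, c) with (- u, - c). *)
Definition separates_from_origin (R : realType) (n : nat)
    (H A : set 'rV[R]_n.+1) : Prop :=
  exists (u : 'cV[R]_n.+1) (c : R),
    [/\ H = [set x | (x *m u) 0 0 = c], 0 < c
      & forall x, A x -> c < (x *m u) 0 0].

Definition hyp (R : realType) (n : nat) (i j : 'I_n.+1) (c : R) :
    set 'rV[R]_n.+1 :=
  [set x | x 0 i - x 0 j = c].

Definition regions (R : realType) (n : nat) (A : set (set 'rV[R]_n.+1)) :
    set (set 'rV[R]_n.+1) :=
  let U := ~` (\bigcup_(H in A) H) in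
  [set C | exists2 x, U x & C = connected_component U x].

Definition is_ceiling (R : realType) (n : nat) (C H : set 'rV[R]_n.+1) : Prop :=
  [/\ ~ H 0,
      exists F, is_facet (closure C) F /\ affine_span F = H
    & ~ separates_from_origin H C].

Definition dominant (R : realType) (n : nat) (C : set 'rV[R]_n.+1) : Prop :=
  forall x, C x -> forall i j : 'I_n.+1, (i < j)%N -> x 0 j < x 0 i.

Definition is_graph (n : nat) (G : {set 'I_n.+1 * 'I_n.+1}) : Prop :=
  forall i j : 'I_n.+1, (i, j) \in G -> (i < j)%N.

Definition complete_graph (n : nat) : {set 'I_n.+1 * 'I_n.+1} :=
  [set p : 'I_n.+1 * 'I_n.+1 | (p.1 < p.2)%N]%SET.

Definition braid (R : realType) (n : nat) : set (set 'rV[R]_n.+1) :=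
  [set H | exists i j : 'I_n.+1, (i < j)%N /\ H = hyp i j 0].

Definition Shi (R : realType) (n : nat) (G : {set 'I_n.+1 * 'I_n.+1}) :
    set (set 'rV[R]_n.+1) :=
  @braid R n `|`
  [set H | exists i j : 'I_n.+1, (i, j) \in G /\ H = hyp i j 1].

Definition Ish (R : realType) (n : nat) (G : {set 'I_n.+1 * 'I_n.+1}) :
    set (set 'rV[R]_n.+1) :=
  @braid R n `|`
  [set H | exists i j : 'I_n.+1, (i, j) \in G /\ H = hyp ord0 j i.+1%:R].

Definition generated_partition (n : nat) (P : 'I_n.+1 -> 'I_n.+1 -> Prop) :
    {set {set 'I_n.+1}} :=
  finset.equivalence_partition (connect (fun i j => `[< P i j \/ P j i >]))
    [set: 'I_n.+1]%SET.

Definition shi_ceiling_partition (R : realType) (n : nat)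
    (C : set 'rV[R]_n.+1) : {set {set 'I_n.+1}} :=
  generated_partition (fun i j => is_ceiling C (hyp i j 1)).

Definition ish_ceiling_partition (R : realType) (n : nat)
    (C : set 'rV[R]_n.+1) : {set {set 'I_n.+1}} :=
  generated_partition (fun i j => is_ceiling C (hyp ord0 j i.+1%:R)).

Definition region_perm (R : realType) (n : nat) (C : set 'rV[R]_n.+1) :
    'S_n.+1 :=
  xget 1%g [set p : 'S_n.+1 | forall x, C x ->
    forall a b : 'I_n.+1, (a < b)%N -> x 0 (p b) < x 0 (p a)].

Definition shi_diagram (R : realType) (n : nat) (C : set 'rV[R]_n.+1) :
    'S_n.+1 * {set {set 'I_n.+1}} :=
  let p := region_perm C in
  (p, generated_partition (fun a b => is_ceiling C (hyp (p a) (p b) 1))).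

Definition ish_diagram (R : realType) (n : nat) (C : set 'rV[R]_n.+1) :
    'S_n.+1 * {ffun 'I_n.+1 -> nat} :=
  let p := region_perm C in
  (p, [ffun j => xget 0%N [set i : nat | (1 <= i <= n.+1)%N /\
                            is_ceiling C (hyp ord0 (p j) i%:R)]]).

Definition shi_identified (R : realType) (n : nat)
    (G : {set 'I_n.+1 * 'I_n.+1}) (C D : set 'rV[R]_n.+1) : Prop :=
  [/\ regions (@Shi R n G) C, regions (@Shi R n (complete_graph n)) D
    & shi_diagram C = shi_diagram D].

Definition ish_identified (R : realType) (n : nat)
    (G : {set 'I_n.+1 * 'I_n.+1}) (C D : set 'rV[R]_n.+1) : Prop :=
  [/\ regions (@Ish R n G) C, regions (@Ish R n (complete_graph n)) D
    & ish_diagram C = ish_diagram D].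

Definition ish_to_complete (R : realType) (n : nat)
    (G : {set 'I_n.+1 * 'I_n.+1}) (C : set 'rV[R]_n.+1) : set 'rV[R]_n.+1 :=
  xget set0 [set D | ish_identified G C D].

Definition shi_of_complete (R : realType) (n : nat)
    (G : {set 'I_n.+1 * 'I_n.+1}) (D : set 'rV[R]_n.+1) : set 'rV[R]_n.+1 :=
  xget set0 [set C | shi_identified G C D].

Definition in_range (n k : nat) (w : {ffun 'I_n.+1 -> nat}) : Prop :=
  forall i, (1 <= w i <= k)%N.

Definition parking (n : nat) (w : {ffun 'I_n.+1 -> nat}) : Prop :=
  in_range n.+1 w /\
  forall i : 'I_n.+1, (nth 0%N (sort leq (codom w)) i <= i.+1)%N.

Definition block_min (n : nat) (P : {set {set 'I_n.+1}}) (a : 'I_n.+1) :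
    'I_n.+1 :=
  [arg min_(b < a in finset.pblock P a) (b : nat)]%N.

Definition park_word (R : realType) (n : nat) (C : set 'rV[R]_n.+1) :
    {ffun 'I_n.+1 -> nat} :=
  let: (p, P) := shi_diagram C in
  [ffun i => (block_min P ((p^-1)%g i)).+1].

Definition omega (R : realType) (n : nat) (w : {ffun 'I_n.+1 -> nat}) :
    set 'rV[R]_n.+1 :=
  xget set0 [set C | regions (@Shi R n (complete_graph n)) C /\
                     park_word C = w].

Definition rook_word (n : nat) (w : {ffun 'I_n.+1 -> nat}) : Prop :=
  in_range n.+1 w /\
  forall k : nat, (1 <= k <= w ord0)%N -> exists i, w i = k.

(* The alphabet is {1, ..., n.+2}; the letter n.+2 is sent to 1. *)
Definition shift_word (n : nat) (w : {ffun 'I_n.+1 -> nat}) :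
    {ffun 'I_n.+1 -> nat} :=
  [ffun i => (w i %% n.+2).+1].

(* Only the values of beta on words satisfying rook_word are meaningful. *)
Definition beta (n : nat) (w : {ffun 'I_n.+1 -> nat}) :
    {ffun 'I_n.+1 -> nat} :=
  xget w [set v | parking v /\ exists k : nat, v = iter k (@shift_word n) w].

(* A cell is a pair (column, row). *)
Definition board (n : nat) : set ('I_n.+1 * nat) :=
  [set c : 'I_n.+1 * nat | (1 <= c.2 <= n.+1 + c.1)%N].

Definition rook_placement (n : nat) (Q : set ('I_n.+1 * nat)) : Prop :=
  Q `<=` @board n /\
  forall c d, Q c -> Q d -> (c.1 = d.1 \/ c.2 = d.2) -> c = d.

Definition valid_placement (n : nat) (Q : set ('I_n.+1 * nat)) : Prop :=
  [/\ rook_placement Q,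
      forall Q', rook_placement Q' -> Q `<=` Q' -> Q' = Q
    & forall r, Q (ord0, r) ->
        forall s : nat, (1 <= s < r)%N -> exists i, Q (i, s)].

Definition rho (R : realType) (n : nat) (C : set 'rV[R]_n.+1) :
    set ('I_n.+1 * nat) :=
  let: (p, eps) := ish_diagram C in
  [set c | exists i : 'I_n.+1, let a := (p^-1)%g i in
     c = (i, if eps a == 0%N then a.+1 else (n.+1 + eps a)%N)].

Definition rook_row (n : nat) (Q : set ('I_n.+1 * nat)) (i : 'I_n.+1) : nat :=
  xget 0%N [set r | Q (i, r)].

(* When column i is processed, ws is the list of the letters of the previous
   columns; its entry of index k is the letter of column k.+1.  Only the values
   of lambda on placements satisfying valid_placement are meaningful. *)
Definition lambda (n : nat) (Q : set ('I_n.+1 * nat)) :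
    {ffun 'I_n.+1 -> nat} :=
  let step (ws : seq nat) (i : 'I_n.+1) :=
    let r := rook_row Q i in
    rcons ws (if (r <= n.+1)%N then r else nth 0%N ws (r - n.+1).-1) in
  let w := foldl step [::] (enum 'I_n.+1) in
  [ffun i : 'I_n.+1 => nth 0%N w i].

Definition ish_to_shi (R : realType) (n : nat) (G : {set 'I_n.+1 * 'I_n.+1})
    (C : set 'rV[R]_n.+1) : set 'rV[R]_n.+1 :=
  shi_of_complete G (omega (beta (lambda (rho (ish_to_complete G C))))).

(* Main.v *)
(* For a fixed order pi of the coordinates, let an active pair (i < j) of the
   graph be one whose hyperplane meets the cone of pi, and compare active pairs
   (i, j) by the position of j together with a key of i: the position of i for
   Shi, the label i itself for Ish.  A region inside the cone amounts to an order
   ideal of active pairs, those for which the region lies on the side of the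
   origin.  Every order ideal occurs, so the ceilings are exactly the maximal
   elements of the ideal, and a region amounts to pi together with an antichain
   M of pairs; M is the set of arcs of the ceiling partition.

   Such a diagram (pi, M) is encoded by the word w that is constant along the
   arcs of M and sends a label without predecessor to its position.  Then M is
   the set of arcs of the position partition of w, and pi is recovered because
   the labels with a predecessor fill the remaining positions in the order of
   the keys of their predecessors.  In the Shi case w is the parking word of the
   region, in the Ish case it is the rook word produced by the lasers, and the
   rotation beta between the two kinds of words does not change position
   partitions.  A dominant region has the same word on both sides, and this word
   is both a parking function and a rook word, hence fixed by beta. *)

Require Import Defs.
From mathcomp Require Import all_boot all_order all_algebra fingroup perm.
From mathcomp Require Import all_classical all_reals topology normedtype.
From mathcomp Require Import zify ring lra.

Set Implicit Arguments.
Unset Strict Implicit.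
Unset Printing Implicit Defensive.

Import Order.TTheory GRing.Theory Num.Theory.
Import numFieldNormedType.Exports.

Local Open Scope classical_set_scope.
Local Open Scope ring_scope.


(** * Cells and ceilings of arrangements of hyperplanes [x_i - x_j = c] *)

Section Arrangement.
Variables (R : realType) (n : nat).
Notation vec := 'rV[R]_n.+1.
Notation triple := ('I_n.+1 * 'I_n.+1 * R)%type.
Implicit Types (t : triple) (T : seq triple) (x y z : vec) (i j : 'I_n.+1).

Definition hval t x : R := x 0 t.1.1 - x 0 t.1.2 - t.2.

Definition arrangement T : set (set vec) :=
  [set H | exists2 t, t \in T & H = hyp t.1.1 t.1.2 t.2].

Definition generic T x := forall t, t \in T -> hval t x != 0.

Definition cell T x : set vec :=
  [set y | forall t, t \in T -> 0 < hval t x * hval t y].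

Lemma hval_conv t (l : R) x y :
  hval t (y + l *: (x - y)) = hval t y + l * (hval t x - hval t y).
Proof. by rewrite /hval !mxE; ring. Qed.

Lemma mul_hval_conv t (u l : R) x y :
  u * hval t (y + l *: (x - y)) =
  u * hval t y + l * (u * hval t x - u * hval t y).
Proof. by rewrite hval_conv; ring. Qed.

Lemma conv_gt0 (l a b : R) : 0 <= l <= 1 -> 0 <= a -> 0 < b ->
  (0 < l) || (0 < a) -> 0 < a + l * (b - a).
Proof.
move=> /andP[l0 l1] a0 b0 la.
have -> : a + l * (b - a) = l * b + (1 - l) * a by ring.
have [l_gt0|] := ltrP 0 l.
  by rewrite ltr_pwDl ?mulr_gt0 // mulr_ge0 // subr_ge0.
move=> l_le0; have l00 : l = 0 by apply/eqP; rewrite eq_le l_le0.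
by move: la; rewrite l00 ltxx /= mul0r add0r subr0 mul1r.
Qed.

Lemma generic_cell T x : generic T x -> cell T x x.
Proof. by move=> gx t tT; rewrite -expr2 exprn_even_gt0 //=; exact: gx. Qed.

Lemma hval_continuous t : continuous (hval t : vec -> R).
Proof.
move=> x.
apply: (@continuousB _ _ _ (fun x : vec => x 0 t.1.1 - x 0 t.1.2) (fun=> t.2)).
  by apply: (@continuousB _ _ _ (fun x : vec => x 0 t.1.1) (fun x => x 0 t.1.2));
    exact: coord_continuous.
exact: cst_continuous.
Qed.

Lemma arrangement_genericE T x :
  (~` \bigcup_(H in arrangement T) H) x <-> generic T x.
Proof.
split=> [nx t tT | gx [H [t tT ->]] /eqP].
  apply/eqP => /eqP; rewrite /hval subr_eq0 => /eqP tx.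
  by apply: nx; exists (hyp t.1.1 t.1.2 t.2) => //; exists t.
by rewrite -subr_eq0; apply/negP; exact: gx.
Qed.

Lemma segment_continuous x y :
  continuous (fun l : R => y + l *: (x - y) : vec).
Proof.
move=> l.
apply: (@continuousD _ _ _ (fun=> y) (fun l : R => l *: (x - y))).
  exact: cst_continuous.
by apply: cvgZr_tmp; exact: cvg_id.
Qed.

(** No [hval t] changes sign on a connected set without vanishing. Conversely, the segment from a
    point of the cell to [x] avoids every hyperplane. *)
Lemma cell_connected_component T x : generic T x ->
  connected_component (~` \bigcup_(H in arrangement T) H) x = cell T x.
Proof.
move=> gx; set U := ~` _.
have Ux : U x by apply/arrangement_genericE.
have xC := generic_cell gx.
apply/seteqP; split => [y Cy t tT|y yC].
  have gy : hval t y != 0.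
    by have /arrangement_genericE := connected_component_sub Cy; apply.
  have conn : connected [set hval t z | z in connected_component U x].
    apply: connected_continuous_connected; first exact: component_connected.
    apply: continuous_subspaceT; exact: hval_continuous.
  move/connected_intervalP : conn => itv.
  have Cx : connected_component U x x by exact: connected_component_refl.
  have no0 : ~ [set hval t z | z in connected_component U x] 0.
    move=> [z Cz z0].
    by have /arrangement_genericE/(_ _ tT) := connected_component_sub Cz; rewrite z0 eqxx.
  have tx : [set hval t z | z in connected_component U x] (hval t x) by exists x.
  have ty : [set hval t z | z in connected_component U x] (hval t y) by exists y.
  have := gx _ tT; move: gy.
  case: (ltgtP (hval t x) 0) => // hx; case: (ltgtP (hval t y) 0) => // hy _ _.
  - by rewrite nmulr_rgt0.
  - by case: no0; apply: (itv _ _ tx ty); rewrite !ltW.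
  - by case: no0; apply: (itv _ _ ty tx); rewrite !ltW.
  - by rewrite pmulr_rgt0.
pose f (l : R) : vec := y + l *: (x - y).
have fc : connected [set f l | l in `[0 : R, 1]].
  apply: connected_continuous_connected; first exact: segment_connected.
  by apply: continuous_subspaceT; exact: segment_continuous.
have sub : [set f l | l in `[0 : R, 1]] `<=` connected_component U x.
  apply: connected_component_max => //.
    by exists 1; rewrite /f ?scale1r /= ?in_itv /= ?ler01 ?lexx // addrC subrK.
  move=> z [l /=]; rewrite in_itv /= => /andP[l0 l1] <-.
  apply/arrangement_genericE => t tT; apply/eqP => /(congr1 (fun r => hval t x * r)).
  rewrite mulr0 mul_hval_conv => e.
  have := conv_gt0 (l := l) _ (ltW (yC _ tT)) (xC _ tT).
  by rewrite l0 l1 (yC _ tT) orbT e ltxx => /(_ isT isT).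
by apply: sub; exists 0; rewrite /f ?scale0r ?addr0 //= in_itv /= lexx ler01.
Qed.

Lemma arrangement_regionsE T (C : set vec) :
  regions (arrangement T) C <-> exists2 x, generic T x & C = cell T x.
Proof.
split=> [[x Ux ->]|[x gx ->]].
  have gx : generic T x by apply/arrangement_genericE.
  by exists x => //; rewrite cell_connected_component.
by exists x; [apply/arrangement_genericE|rewrite cell_connected_component].
Qed.

Lemma eps_seq (I : eqType) (s : seq I) (a b : I -> R) :
  (forall k, k \in s -> 0 < a k) ->
  exists2 e : R, 0 < e <= 1 & forall l k, 0 <= l <= e -> k \in s -> 0 < a k + l * b k.
Proof.
elim: s => [|i s IH] as0; first by exists 1 => //; rewrite ltr01 lexx.
have [|e /andP[e0 e1] eP] := IH.
  by move=> k ks; apply: as0; rewrite inE ks orbT.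
have ai : 0 < a i by apply: as0; rewrite inE eqxx.
have bi : 0 < `|b i| + 1 by rewrite ltr_wpDl.
(* This gives [l * |b i| <= a i / 2]; the added 1 keeps the divisor positive when [b i = 0]. *)
exists (Num.min e (a i / (2 * (`|b i| + 1)))).
  by rewrite lt_min e0 ge_min e1 divr_gt0 // mulr_gt0.
move=> l k /andP[l0]; rewrite le_min => /andP[le lb]; rewrite inE => /orP[/eqP ->|ks].
  move: lb; rewrite ler_pdivlMr ?mulr_gt0 // => lb.
  have : `|l * b i| <= l * `|b i| by rewrite normrM (ger0_norm l0).
  rewrite ler_norml => /andP[h _]; nra.
by apply: eP => //; rewrite l0 le.
Qed.

Lemma cell_open_dir T x y z : cell T x y ->
  exists2 e : R, 0 < e <= 1 & cell T x (y + e *: (z - y)).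
Proof.
move=> xy.
have [e e01 eP] := @eps_seq _ T (fun t => hval t x * hval t y)
  (fun t => hval t x * hval t z - hval t x * hval t y) xy.
exists e => // t tT; rewrite mul_hval_conv.
by apply: eP => //; case/andP: e01 => /ltW -> _ /=.
Qed.

(** A negative product at [y] would persist nearby; conversely, moving slightly from [y] towards [x]
    makes all weak inequalities strict. *)
Lemma cell_closureE T x : generic T x ->
  closure (cell T x) = [set y | forall t, t \in T -> 0 <= hval t x * hval t y].
Proof.
move=> gx; apply/seteqP; split=> [y cy t tT|y yC B By].
  rewrite leNgt; apply/negP => lt0.
  have cont : continuous (fun z => hval t x * hval t z).
    move=> z; apply: (@continuousM _ _ (fun=> hval t x) (hval t)).
      exact: cst_continuous.
    exact: hval_continuous.
  have : nbhs y [set z | hval t x * hval t z < 0].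
    apply: (cont y [set r : R | r < 0]).
    have o : open [set r : R | r < 0] by exact: open_lt.
    exact: (open_nbhs_nbhs (conj o lt0)).
  by move=> /cy [z [zC]] /=; rewrite ltNge (ltW (zC _ tT)).
have : nbhs (0 : R) [set l | B (y + l *: (x - y))].
  have := @segment_continuous x y 0; rewrite /= => h.
  by apply: (h B); rewrite scale0r addr0.
move=> /nbhs_ballP [e /= e0 eB].
have [l /andP[l0 l1] le] : exists2 l : R, 0 < l <= 1 & l < e.
  exists (Num.min 1 (e / 2)).
    by rewrite lt_min ltr01 divr_gt0 //= ge_min lexx.
  by rewrite gt_min ltr_pdivrMr // ltr_pMr // ltr1n orbT.
exists (y + l *: (x - y)); split; last first.
  by apply: eB; rewrite /ball /= sub0r normrN gtr0_norm.
move=> t tT; rewrite mul_hval_conv.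
by apply: conv_gt0; rewrite ?(ltW l0) ?l0 //; [exact: yC|exact: (generic_cell gx tT)].
Qed.

Definition hyp_col i j : 'cV[R]_n.+1 := delta_mx i 0 - delta_mx j 0.

Lemma mul_hyp_col x i j : (x *m hyp_col i j) 0 0 = x 0 i - x 0 j.
Proof. by rewrite mulmxBr -!colE !mxE. Qed.

Lemma affine_span_hyp (A : set vec) i j (c : R) :
  A `<=` hyp i j c -> affine_span A `<=` hyp i j c.
Proof.
move=> Ac _ [k [p [a [Ap sa ->]]]]; rewrite /hyp /= !summxE -sumrB.
rewrite (eq_bigr (fun k => a k * c)) -?mulr_suml ?sa ?mul1r // => l _.
by rewrite !mxE -mulrBr (Ac _ (Ap l)).
Qed.

(** The point [z] is extrapolated with weights [1 - e^-1] and [e^-1], so a short step from [y]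
    towards [z] inside [A] is enough to span [z]. *)
Lemma affine_span_line (A : set vec) (e : R) y z :
  e != 0 -> A y -> A (y + e *: (z - y)) -> affine_span A z.
Proof.
move=> e0 Ay Az; exists 2%N.
exists (fun k : 'I_2 => if k == 0 then y else y + e *: (z - y)).
exists (fun k : 'I_2 => if k == 0 then 1 - e^-1 else e^-1); split.
- by move=> k; case: ifP.
- by rewrite !big_ord_recl big_ord0 /= addr0 subrK.
- rewrite !big_ord_recl big_ord0 /= addr0; apply/rowP => k; rewrite !mxE.
  by field.
Qed.

(** Shows later that a facet spanning one hyperplane lies in no other. The sign condition on [c']
    rules out the second equation [x_j - x_i = -c] of the same hyperplane. *)
Lemma hyp_subset i j (c : R) i' j' (c' : R) :
  0 < c -> i' != j' -> 0 <= c' -> hyp i j c !=set0 ->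
  hyp i j c `<=` hyp i' j' c' -> (i, j, c) = (i', j', c').
Proof.
move=> c0 ij' c'0 [z]; rewrite /hyp /= => zc sub.
have ij : i != j by apply/eqP => e; move: zc; rewrite e subrr => e0; rewrite e0 ltxx in c0.
have ji : j != i by rewrite eq_sym.
pose q (a b : R) : vec := a *: delta_mx 0 i + b *: delta_mx 0 j.
have qE a b k : q a b 0 k = a *+ (k == i) + b *+ (k == j).
  by rewrite !mxE !eqxx /= !mulr_natr.
have := sub (q 0 (- c)); have := sub (q c 0).
rewrite /hyp /= !qE !eqxx (negbTE ij) (negbTE ji) !mulr1n !mulr0n !mul0rn.
rewrite !(addr0, add0r, subr0, opprK, sub0r) => /(_ erefl) h1 /(_ erefl) h2.
have [i'i|i'i] := eqVneq i' i.
  subst i'; move: h1 h2; rewrite eqxx (negbTE ij) (eq_sym j') (negbTE ij').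
  rewrite !mulr0n mulr1n subr0 => <-.
  have [-> //|_] := eqVneq j' j; rewrite mulr0n => h2.
  by exfalso; lra.
have [j'i|j'i] := eqVneq j' i.
  exfalso; move: h1; rewrite (negbTE i'i) j'i eqxx mulr0n mulr1n; lra.
move: h1; rewrite (negbTE i'i) (negbTE j'i) mulr0n subrr => c'00.
have [i'j|i'j] := eqVneq i' j.
  exfalso; move: h2; rewrite i'j eqxx (eq_sym j') -i'j (negbTE ij') mulr0n mulr1n -c'00; lra.
have [j'j|j'j] := eqVneq j' j.
  exfalso; move: h2; rewrite (negbTE i'j) j'j eqxx mulr0n mulr1n -c'00; lra.
(* Here [i'] and [j'] differ from [i] and [j], and [c' = 0]: moving in direction [i'] stays in the
   first hyperplane but leaves the second. *)
have qdE k : (q c 0 + delta_mx 0 i') 0 k = q c 0 0 k + (k == i')%:R.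
  by rewrite !mxE.
have := sub (q c 0 + delta_mx 0 i'); rewrite /hyp /= !qdE !qE !mul0rn !eqxx.
rewrite (negbTE ji) (eq_sym i) (eq_sym j i') (eq_sym j' i').
rewrite (negbTE i'i) (negbTE i'j) (negbTE j'i) (negbTE ij') !mulr0n mulr1n.
rewrite -c'00 !addr0 !add0r subr0 => /(_ erefl) /eqP.
by rewrite subr0 oner_eq0.
Qed.
End Arrangement.

(** * Facets of cells and ceilings *)

Section Ceilings.
Variables (R : realType) (n : nat).
Notation vec := 'rV[R]_n.+1.
Notation triple := ('I_n.+1 * 'I_n.+1 * R)%type.
Implicit Types (t : triple) (T : seq triple) (x y z : vec) (i j : 'I_n.+1).

Lemma hypE i j (c : R) y : hyp i j c y <-> hval (i, j, c) y = 0.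
Proof.
by rewrite /hyp /hval /=; split => [->|/eqP]; rewrite ?subrr // subr_eq0 => /eqP.
Qed.

Lemma mulmx_conv (u : 'cV[R]_n.+1) (l : R) y z :
  ((y + l *: (z - y)) *m u) 0 0 =
  (y *m u) 0 0 + l * ((z *m u) 0 0 - (y *m u) 0 0).
Proof. by rewrite mulmxDl -scalemxAl mulmxBl !mxE. Qed.

Lemma affine_dim_full (A : set vec) T x :
  cell T x `<=` A -> cell T x x -> affine_dim A n.+1.
Proof.
move=> CA xC; exists 0, fullv; split; last by rewrite dimvf /dim /= mul1n.
apply/seteqP; split => z _; first by rewrite /= memvf.
have [e /andP[e0 _] ze] := cell_open_dir z xC.
by apply: (affine_span_line (e := e) (y := x)); rewrite ?lt0r_neq0 //; apply: CA.
Qed.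

Lemma hyp_span_dim i j (c : R) (A : set vec) y : i != j -> affine_span A = hyp i j c ->
  hyp i j c y -> affine_dim A n.
Proof.
move=> ij AE yH.
pose f := linfun (mulmxr (@hyp_col R n i j) : 'rV[R]_n.+1 -> 'rV[R]_1).
exists y, (lker f); split.
  rewrite AE; apply/seteqP; split=> z; rewrite /hyp /= memv_ker lfunE /=; last move/eqP.
    move=> zH; apply/eqP/matrixP => a b; rewrite !ord1 mul_hyp_col !mxE.
    by rewrite opprD addrACA -opprD zH yH subrr.
  move/matrixP => /(_ 0 0); rewrite mul_hyp_col !mxE => e.
  by rewrite -yH; lra.
have := limg_ker_dim f fullv; rewrite dimvf /dim /= mul1n capfv.
suff -> : \dim (f @: fullv) = 1%N by rewrite addn1 => -[].
apply/eqP; rewrite eqn_leq; apply/andP; split.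
  by rewrite (leq_trans (dimvS (subvf _))) // dimvf /dim /= muln1.
rewrite lt0n dimv_eq0; apply/eqP => f0.
have : f (delta_mx 0 i) \in (f @: fullv)%VS by apply: memv_img; exact: memvf.
rewrite f0 memv0 lfunE /= => /eqP/matrixP/(_ 0 0).
rewrite mul_hyp_col !mxE !eqxx /= eq_sym (negbTE ij) subr0 => /eqP.
by rewrite oner_eq0.
Qed.

(** A separating hyperplane would meet the segment from the origin to [x], but [x_i - x_j] stays
    below [c] along it. *)
Lemma hyp_not_separated T x i j (c : R) : 0 < c -> cell T x x ->
  hval (i, j, c) x < 0 -> ~ separates_from_origin (hyp i j c) (cell T x).
Proof.
move=> c0 xC xlt [u [d [HE d0 sep]]].
have xd := sep _ xC; set X := (x *m u) 0 0 in xd.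
have X0 : 0 < X by apply: lt_trans xd.
have : hyp i j c (d / X *: x).
  by rewrite HE /= -scalemxAl mxE -/X divfK // gt_eqF.
rewrite /hyp /= !mxE -mulrBr.
have l0 : 0 < d / X by rewrite divr_gt0.
have l1 : d / X < 1 by rewrite ltr_pdivrMr // mul1r.
move: xlt; rewrite /hval /=; set a := x 0 i - x 0 j; set l := d / X in l0 l1 *.
move=> ac e; nra.
Qed.

Lemma hyp_separates T x i j (c : R) : 0 < c -> (i, j, c) \in T ->
  0 < hval (i, j, c) x -> separates_from_origin (hyp i j c) (cell T x).
Proof.
move=> c0 tT xgt; exists (hyp_col R i j), c; split => //.
  by rewrite /hyp; apply/seteqP; split=> y /=; rewrite mul_hyp_col.
move=> y /(_ _ tT); rewrite (pmulr_rgt0 _ xgt) /hval /= subr_gt0.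
by rewrite mul_hyp_col.
Qed.

Definition wf_triples T := forall t, t \in T -> t.1.1 != t.1.2 /\ 0 <= t.2.

(** The point [y] is a relative interior point of the facet: near it the hyperplane lies in the
    closure of the cell, so the facet spans the hyperplane. The sign at [x] puts the region on the
    side of the origin. *)
Lemma ceilingP T x i j (c : R) : wf_triples T -> generic T x -> 0 < c ->
  is_ceiling (cell T x) (hyp i j c) <->
  [/\ (i, j, c) \in T, hval (i, j, c) x < 0
    & exists2 y, hval (i, j, c) y = 0 &
        forall t, t \in T -> t != (i, j, c) -> 0 < hval t x * hval t y].
Proof.
move=> wfT gx c0; have xC := generic_cell gx; have clE := cell_closureE gx.
split=> [[_ [F [[[u [d [ud FE]]] [k [Fk Pk]]] FH]] nsep] | [tT xlt [y y0 yT]]].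
  have [y0 Fy0] : F !=set0.
    have [z0 [V [FV _]]] := Fk; apply: contrapT => F0.
    have : affine_span F z0 by rewrite FV /= subrr mem0v.
    move=> [m [p [a [Fp sa _]]]]; case: m p a Fp sa => [|m] p a Fp sa.
      by move: sa; rewrite big_ord0 => /eqP; rewrite eq_sym oner_eq0.
    by apply: F0; exists (p ord0).
  have subF : F `<=` hyp i j c.
    rewrite -FH => z Fz; apply: (affine_span_line (e := 1) (y := z));
    by rewrite ?oner_neq0 ?subrr ?scaler0 ?addr0.
  have Fcl z : F z -> forall t, t \in T -> 0 <= hval t x * hval t z.
    by rewrite FE clE => -[].
  have Fconv y z : F y -> F z -> F (y + 2^-1 *: (z - y)).
    rewrite FE clE => -[yC yd] [zC zd]; split=> [t tT|].
      rewrite mul_hval_conv; have := yC _ tT; have := zC _ tT; lra.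
    by move: yd zd; rewrite /= mulmx_conv => -> ->; rewrite subrr mulr0 addr0.
  (* A facet is contained in no other hyperplane, so averaging points of it
     gives a point off all of them. *)
  have [y Fy yT] : exists2 y, F y &
      forall t, t \in T -> t != (i, j, c) -> 0 < hval t x * hval t y.
    have : {subset T <= T} by [].
    elim: {-2}T => [|t s IH] sT; first by exists y0.
    have [|y Fy yT] := IH; first by move=> r rs; apply: sT; rewrite inE rs orbT.
    have tT : t \in T by apply: sT; rewrite inE eqxx.
    have [tH|ntH] := eqVneq t (i, j, c).
      exists y => // r; rewrite inE => /orP[/eqP ->|]; last exact: yT.
      by rewrite tH eqxx.
    have [z Fz tz] : exists2 z, F z & hval t z != 0.
      apply: contrapT => h; move/eqP: ntH; apply.
      have sub : F `<=` hyp t.1.1 t.1.2 t.2.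
        move=> z Fz; apply/hypE; case: (eqVneq (hval t z) 0) => [|tz].
          by case: t {sT IH tT h yT} => [[]].
        by case: h; exists z.
      have [tne tge] := wfT _ tT.
      have := @hyp_subset _ _ i j c t.1.1 t.1.2 t.2 c0 tne tge.
      case: t {sT IH tT h yT tne tge} sub => [[a b] e] /= sub -> //.
        by exists y0; exact: subF.
      by rewrite -FH; exact: affine_span_hyp.
    exists (y + 2^-1 *: (z - y)); first exact: Fconv.
    move=> r; rewrite inE mul_hval_conv => /orP[/eqP -> _|rs rne].
      have zt : 0 < hval t x * hval t z.
        by rewrite lt0r Fcl // andbT mulf_neq0 //; exact: gx.
      have := Fcl _ Fy _ tT; lra.
    have := yT _ rs rne.
    have := Fcl _ Fz r (sT _ _); rewrite inE rs orbT => /(_ isT); lra.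
  (* Otherwise [y] would lie in the open cell. A linear form maximal at an interior point is
     constant, so the whole cell would lie in [F], hence in the hyperplane, against openness. *)
  have tT : (i, j, c) \in T.
    apply: contrapT => tnT.
    have yC : cell T x y.
      by move=> t tT'; apply: yT => //; apply/eqP => e; rewrite e in tT'.
    have [_ yd] : closure (cell T x) y /\ (y *m u) 0 0 = d by move: Fy; rewrite FE.
    have le z : (z *m u) 0 0 <= (y *m u) 0 0.
      have [e /andP[e0 _] /(@subset_closure _ _) /ud] := cell_open_dir z yC.
      by rewrite mulmx_conv -yd gerDl pmulr_rle0 // subr_le0.
    have CF : cell T x `<=` F.
      move=> z zC; rewrite FE; split; first exact: subset_closure.
      rewrite /= -yd; apply/eqP; rewrite eq_le le /=.
      (* The reflection of [z] in [y] gives the reverse inequality. *)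
      have := le (y + (- 1) *: (z - y)); rewrite mulmx_conv; lra.
    have yc : y 0 i - y 0 j = c by exact: subF.
    have ij : i != j by apply/eqP => ij; move: c0; rewrite -yc ij subrr ltxx.
    have [e /andP[e0 _] /CF /subF] := cell_open_dir (y + delta_mx 0 i) yC.
    rewrite /hyp /= !mxE !eqxx eq_sym (negbTE ij) /=; lra.
  have xlt : hval (i, j, c) x < 0.
    rewrite ltNge; apply/negP => xge; apply: nsep; apply: hyp_separates => //.
    by rewrite lt0r xge andbT; exact: gx.
  split => //; exists y => //; apply/hypE; exact: subF.
have yH : hyp i j c y by apply/hypE.
have [ij _] := wfT _ tT; rewrite /= in ij.
split; first by rewrite /hyp /= !mxE subrr => /esym/eqP; rewrite gt_eqF.
- exists (closure (cell T x) `&` hyp i j c).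
  have FH : affine_span (closure (cell T x) `&` hyp i j c) = hyp i j c.
    apply/seteqP; split; first by apply: affine_span_hyp => z [].
    move=> z zH.
    have [|e /andP[e0 e1] eP] := @eps_seq _ _ [seq t <- T | t != (i, j, c)]
        (fun t => hval t x * hval t y)
        (fun t => hval t x * hval t z - hval t x * hval t y).
      by move=> t; rewrite mem_filter => /andP[? ?]; exact: yT.
    apply: (affine_span_line (e := e) (y := y)); first by rewrite gt_eqF.
      split=> //; rewrite clE => t tT'.
      have [->|tne] := eqVneq t (i, j, c); first by rewrite y0 mulr0.
      by rewrite ltW // yT.
    split; last first.
      by apply/hypE; rewrite hval_conv y0; move/hypE: zH => ->; rewrite subrr mulr0 addr0.
    rewrite clE => t tT'; rewrite mul_hval_conv.
    have [->|tne] := eqVneq t (i, j, c).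
      by rewrite y0; move/hypE: zH => ->; rewrite !mulr0 subrr mulr0 addr0.
    by rewrite ltW // eP ?mem_filter ?tne ?tT' // ltW //= lexx.
  split=> //; split.
    exists (hyp_col R i j), c; split.
      move=> z; rewrite clE => /(_ _ tT); rewrite (nmulr_rge0 _ xlt) /hval /= subr_le0.
      by rewrite mul_hyp_col.
    by congr (_ `&` _); apply/seteqP; split=> z; rewrite /hyp /= mul_hyp_col.
  exists n; split; first exact: (hyp_span_dim ij FH yH).
  by apply: affine_dim_full xC; exact: subset_closure.
exact: hyp_not_separated xC xlt.
Qed.
End Ceilings.

(** * Realization of order ideals *)

Lemma seq_max (R : realType) (s : seq R) : s != [::] ->
  exists2 m, m \in s & forall a, a \in s -> a <= m.
Proof.
elim: s => // a s IH _; case: s IH => [|b s] IH.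
  by exists a; rewrite ?inE // => b; rewrite inE => /eqP ->.
have [m ms mP] := IH isT; have [ma|am] := lerP m a.
  exists a; first by rewrite inE eqxx.
  by move=> c; rewrite inE => /orP[/eqP -> //|/mP] cm; exact: le_trans ma.
exists m; first by rewrite inE ms orbT.
by move=> c; rewrite inE => /orP[/eqP ->|/mP //]; exact: ltW.
Qed.

Lemma exists_between (R : realType) (L U : seq R) :
  (forall l u, l \in L -> u \in U -> l < u) ->
  exists2 t, forall l, l \in L -> l < t & forall u, u \in U -> t < u.
Proof.
move=> LU.
have [U0|Un0] := eqVneq U [::].
  have [L0|/seq_max [m mL mP]] := eqVneq L [::]; first by exists 0; rewrite ?U0 ?L0.
  by exists (m + 1); rewrite ?U0 // => l /mP lm; lra.
have [|m mU mP] := @seq_max _ (map -%R U); first by case: (U) Un0.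
have mP' u : u \in U -> - m <= u.
  by move=> uU; rewrite lerNl; apply: mP; exact: map_f.
have [L0|/seq_max [l lL lP]] := eqVneq L [::].
  by exists (- m - 1); rewrite ?L0 // => u /mP' ?; lra.
have lm : l < - m.
  by move/mapP: mU => [u uU ->]; rewrite opprK; exact: LU.
by exists ((l - m) / 2) => [a /lP|a /mP'] ?; lra.
Qed.

(** [B] marks the pairs to be placed at distance less than 1, as in a unit interval order. Points
    are added in decreasing order: the new one goes above [z a - 1] for marked [a], below [z a - 1]
    for the others, and below the last point. Monotonicity of [B] makes these bounds compatible. *)
Lemma realize_unit_intervals (R : realType) (B : nat -> nat -> bool) (m : nat) :
  (forall a b a' b', (a <= a')%N -> (a' < b')%N -> (b' <= b)%N -> B a b -> B a' b') ->
  exists z : nat -> R, forall a b, (a < b)%N -> (b < m)%N ->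
    [/\ z b < z a, z a - z b != 1 & (z a - z b < 1) = B a b].
Proof.
move=> Bmono; elim: m => [|m [z zP]]; first by exists (fun=> 0).
pose L := [seq z a - 1 | a <- iota 0 m & B a m].
pose U := (if m is m'.+1 then [:: z m'] else [::]) ++ [seq z a - 1 | a <- iota 0 m & ~~ B a m].
have zle a b : (a <= b)%N -> (b < m)%N -> z b <= z a.
  by rewrite leq_eqVlt => /orP[/eqP -> //|ab bm]; have [/ltW] := zP _ _ ab bm.
have [l u /mapP [a]|t tL tU] := @exists_between R L U.
  rewrite mem_filter mem_iota /= add0n => /andP[Ba am] ->.
  rewrite mem_cat => /orP[|/mapP [b]].
    case: m {L U} zP zle Ba am => // m zP zle Ba am; rewrite inE => /eqP ->.
    move: am; rewrite ltnS leq_eqVlt => /orP[/eqP ->|am]; first by lra.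
    have [_ _] := zP a m am (ltnSn m).
    by rewrite (Bmono _ _ _ _ (leqnn a) am (leqnSn m) Ba); lra.
  rewrite mem_filter mem_iota /= add0n => /andP[nBb bm] ->.
  rewrite ltrD2r; have [ab|ba] := leqP a b.
    by rewrite (Bmono _ _ _ _ ab bm (leqnn m) Ba) in nBb.
  by have [] := zP _ _ ba am.
exists (fun a => if a == m then t else z a) => a b ab.
rewrite ltnS leq_eqVlt => /orP[/eqP bm|bm]; last first.
  rewrite (ltn_eqF bm) (ltn_eqF (ltn_trans ab bm)); exact: zP.
subst b; rewrite eqxx (ltn_eqF ab).
have tza : t < z a.
  case: m {L tL} zP zle ab @U tU => // m zP zle ab U tU.
  by apply: lt_le_trans (zle a m ab (ltnSn m)); apply: tU; rewrite mem_cat inE eqxx.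
have [Ba|nBa] := boolP (B a m).
  have : z a - 1 < t by apply/tL/map_f; rewrite mem_filter Ba mem_iota.
  by move=> h; split => //; [apply/eqP; lra|apply/idP; lra].
have : t < z a - 1.
  apply: tU; rewrite mem_cat; apply/orP; right; apply/map_f.
  by rewrite mem_filter nBa mem_iota.
by move=> h; split => //; [apply/eqP; lra|apply/negbTE; rewrite -leNgt; lra].
Qed.

Lemma card_ord_lt n m : (m <= n)%N -> #|[set i : 'I_n | (i < m)%N]%SET| = m.
Proof. by move=> mn; rewrite cardsE -sum1_card (big_ord_narrow mn) sum1_card card_ord. Qed.

(** * Orders of the coordinates and active pairs, for Shi and Ish together *)

Section Diagrams.
Variables (R : realType) (n : nat).
Notation lab := 'I_n.+1.
Notation vec := 'rV[R]_n.+1.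
Implicit Types (s : bool) (p q : 'S_n.+1) (x y z : vec) (i j a b : lab)
  (G M S : {set lab * lab}).

Definition pos p i : lab := (p^-1)%g i.

Lemma posK p : cancel (pos p) p. Proof. by move=> i; rewrite /pos permKV. Qed.
Lemma permposK p : cancel p (pos p). Proof. by move=> i; rewrite /pos permK. Qed.
Lemma pos_inj p : injective (pos p). Proof. exact: can_inj (posK p). Qed.

(* [s = true] is the Shi case and [s = false] the Ish case: the pair [(i, j)]
   of the graph gives the hyperplane [x_(hd s i) - x_j = lvl s i]. *)
Definition hd s i : lab := if s then i else ord0.
Definition lvl s i : R := if s then 1 else i.+1%:R.
Definition key s p i : nat := if s then pos p i else i.
Definition active s p i j := (pos p (hd s i) < pos p j)%N.
Definition pair_hval s i j x : R := hval (hd s i, j, lvl s i) x.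
Definition arr s G := if s then @Shi R n G else @Ish R n G.

Definition ordered p x := forall a b, (a < b)%N -> x 0 (p b) < x 0 (p a).

(** The order ideal generated by [S]: a larger key and an earlier second label can only decrease the
    value of a pair, by [hval_le]. *)
Definition ideal s p S i j :=
  [exists m in S, (key s p m.1 <= key s p i)%N && (pos p j <= pos p m.2)%N].

Lemma key_inj s p : injective (key s p).
Proof.
by rewrite /key; case: s => i j /val_inj // /pos_inj.
Qed.

Lemma lvl_gt0 s i : 0 < lvl s i.
Proof. by rewrite /lvl; case: s; rewrite ?ltr01 ?ltr0n. Qed.

Lemma hd_neq s i j : (i < j)%N -> hd s i != j.
Proof.
move=> ij; rewrite /hd; case: s; last by rewrite -val_eqE /= eq_sym -lt0n (leq_trans _ ij).
by apply/eqP => e; rewrite e ltnn in ij.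
Qed.

Lemma ordered_lt p x i j : ordered p x -> (x 0 j < x 0 i) = (pos p i < pos p j)%N.
Proof.
move=> px; case: (ltngtP (pos p i) (pos p j)) => [/px|/px|/val_inj/pos_inj ->].
- by rewrite !posK.
- by rewrite !posK => h; apply/negbTE; rewrite -leNgt ltW.
- by rewrite ltxx.
Qed.

Lemma ordered_le p x i j : ordered p x -> (x 0 j <= x 0 i) = (pos p i <= pos p j)%N.
Proof. by move=> px; rewrite leNgt leqNgt (ordered_lt _ _ px). Qed.

(** The position of a label is the number of labels with a strictly larger coordinate, which depends
    on [x] only. *)
Lemma ordered_inj p q x : ordered p x -> ordered q x -> p = q.
Proof.
move=> px qx.
have pq i j : (pos p i < pos p j)%N = (pos q i < pos q j)%N.
  by rewrite -(ordered_lt _ _ px) (ordered_lt _ _ qx).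
have card r i : #|[set j | (pos r j < pos r i)%N]%SET| = pos r i.
  rewrite -[RHS](card_ord_lt (ltnW (ltn_ord (pos r i)))).
  rewrite -[RHS](card_imset _ (@perm_inj _ r)); apply: eq_card => j.
  rewrite inE; apply/idP/imsetP => [ji|[k]]; last by rewrite inE => ki ->; rewrite permposK.
  by exists (pos r j); rewrite ?inE ?posK.
have e : pos p =1 pos q.
  move=> i; apply/val_inj => /=; rewrite -(card p) -(card q).
  by apply: eq_card => j; rewrite !inE pq.
by apply/permP => a; apply: (can_inj (posK q)); rewrite -e !permposK.
Qed.

Lemma perm_of_seq (w : seq lab) : uniq w -> size w = n.+1 ->
  exists p, forall i, pos p i = index i w :> nat.
Proof.
move=> uw sw.
have inj : injective (fun a : lab => nth ord0 w a).
  move=> a b /eqP; rewrite nth_uniq ?sw // => /eqP; exact: val_inj.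
exists (perm inj) => i.
have iw : i \in w.
  have sz : (size (enum lab) <= size w)%N by rewrite size_enum_ord sw.
  have sub : {subset w <= enum lab} by move=> l _; rewrite mem_enum.
  by have [_ ->] := uniq_min_size uw sub sz; rewrite mem_enum.
have lt : (index i w < n.+1)%N by move: iw; rewrite -index_mem sw.
have e : perm inj (Ordinal lt) = i by rewrite permE /= nth_index.
by rewrite -{1}e permposK.
Qed.

Lemma exists_ordered x : (forall i j, i != j -> x 0 i != x 0 j) -> exists p, ordered p x.
Proof.
move=> xinj; pose r i j := x 0 j <= x 0 i.
have rtot : total r by move=> i j; rewrite /r orbC le_total.
have rtr : transitive r by move=> i j k /= h h'; exact: le_trans h' h.
have us : uniq (sort r (enum lab)) by rewrite sort_uniq enum_uniq.
have ss : size (sort r (enum lab)) = n.+1 by rewrite size_sort size_enum_ord.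
have [p pP] := perm_of_seq us ss.
exists p => a b ab.
rewrite lt_neqAle xinj /=; last by apply/eqP => /perm_inj e; rewrite e ltnn in ab.
have srt := sort_sorted rtot (enum lab).
have := sorted_leq_index rtr (fun i => lexx _) srt.
move=> /(_ (p a) (p b)); rewrite !mem_sort !mem_enum => /(_ isT isT); apply.
by rewrite -!pP !permposK ltnW.
Qed.
End Diagrams.

(** * Points of a cone realizing a given ideal *)

Section Realization.
Variables (R : realType) (n : nat).
Notation lab := 'I_n.+1.
Notation vec := 'rV[R]_n.+1.
Implicit Types (s : bool) (p q : 'S_n.+1) (x y z : vec) (i j a b : lab)
  (G M S : {set lab * lab}).

(** In the Shi case a later first label has a smaller coordinate; in the Ish case a larger first
    label has a higher level. *)
Lemma hval_le s p x i j i' j' : ordered p x ->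
  (key s p i <= key s p i')%N -> (pos p j' <= pos p j)%N ->
  pair_hval s i' j' x <= pair_hval s i j x.
Proof.
move=> px; rewrite -(ordered_le _ _ px) /key /pair_hval /hval /hd /lvl /=.
case: s => [|ii' jj']; first by rewrite -(ordered_le _ _ px); lra.
have : i.+1%:R <= i'.+1%:R :> R by rewrite ler_nat.
lra.
Qed.

Lemma hval_inactive s p x i j : (i < j)%N -> ordered p x -> ~~ active s p i j ->
  pair_hval s i j x < 0.
Proof.
move=> ij px; rewrite /active -leqNgt -(ordered_le _ _ px) /pair_hval /hval /=.
have := lvl_gt0 R s i; lra.
Qed.

Lemma realize_shi p S : exists2 x : vec, ordered p x & forall i j, active true p i j ->
  pair_hval true i j x != 0 /\ (pair_hval true i j x < 0) = ideal true p S i j.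
Proof.
pose B (a b : nat) := [exists m in S, (pos p m.1 <= a)%N && (b <= pos p m.2)%N].
have [|z zP] := @realize_unit_intervals R B n.+1.
  move=> a b a' b' aa' _ b'b /exists_inP [m mS /andP[ma bm]].
  by apply/exists_inP; exists m; rewrite // (leq_trans ma) //= (leq_trans b'b).
exists (\row_i z (pos p i)).
  by move=> a b ab; rewrite !mxE !permposK; have [] := zP a b ab (ltn_ord _).
move=> i j; rewrite /active /hd => ij; have [_ ne lt] := zP _ _ ij (ltn_ord _).
by rewrite /pair_hval /hval /lvl /= !mxE subr_eq0 ne subr_lt0 lt.
Qed.

Lemma realize_ish p S : exists2 x : vec, ordered p x & forall i j, active false p i j ->
  pair_hval false i j x != 0 /\ (pair_hval false i j x < 0) = ideal false p S i j.
Proof.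
(* [x_1 - x_j] is placed just below the least level allowed by [S]. *)
pose P (a k : nat) := [exists m in S, (m.1.+1 <= k)%N && (a <= pos p m.2)%N].
(* [U a] is the least allowed level at position [a]; when there is none, [find] returns [n.+2],
   beyond the level of every pair. *)
pose U (a : nat) := find (P a) (iota 0 n.+2).
have Pmono (a b k l : nat) : (a <= b)%N -> (k <= l)%N -> P b k -> P a l.
  move=> ab kl /exists_inP [m mS /andP[mk bm]]; apply/exists_inP; exists m => //.
  by rewrite (leq_trans mk) // (leq_trans ab).
have UP (a k : nat) : (k <= n.+1)%N -> (U a <= k)%N = P a k.
  move=> kn; apply/idP/idP => [Uk|Pk].
    have Un : (U a < n.+2)%N by rewrite ltnS (leq_trans Uk).
    have : has (P a) (iota 0 n.+2) by rewrite has_find size_iota.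
    by move/(nth_find 0%N); rewrite nth_iota // add0n; exact: Pmono.
  rewrite leqNgt; apply/negP => /(before_find 0%N).
  by rewrite nth_iota ?add0n ?Pk.
have Umono (a b : nat) : (a <= b)%N -> (U a <= U b)%N.
  move=> ab; have [Ub|Ub] := leqP (U b) n.+1.
    by rewrite (UP a _ Ub); apply: (Pmono _ _ _ _ ab (leqnn _)); rewrite -(UP b _ Ub).
  by rewrite (leq_trans (find_size _ _)) // size_iota.
have U0 (a : nat) : (0 < U a)%N.
  by rewrite lt0n -leqn0 (UP a) //; apply/exists_inP => -[].
(* The offsets [f] lie strictly between 0 and 1 and separate positions with the same least level. *)
pose f (a : nat) : R := (n.+1 - a)%:R / n.+2%:R.
have f01 (a : nat) : (a <= n)%N -> 0 < f a < 1.
  move=> an; rewrite /f divr_gt0 ?ltr0n ?subn_gt0 ?ltnS //=.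
  by rewrite ltr_pdivrMr ?ltr0n // mul1r ltr_nat ltnS leq_subr.
have fmono (a b : nat) : (a < b)%N -> (b <= n)%N -> f b < f a.
  move=> ab bn; rewrite /f ltr_pM2r ?invr_gt0 ?ltr0n // ltr_nat.
  by rewrite ltn_sub2l // (leq_trans ab) // (leq_trans bn).
set o := pos p ord0.
(* Label 1 gets coordinate 0, positions before it positive integers, and positions after it negative
   values, since [U a] is at least 1. *)
pose z (a : nat) : R := if (a <= o)%N then (o - a)%:R else f a - (U a)%:R.
exists (\row_i z (pos p i)).
  move=> a b ab; rewrite !mxE !permposK /z.
  have bn : (b <= n)%N by rewrite -ltnS.
  have [bo|ob] := leqP b o.
    by rewrite (leq_trans (ltnW ab) bo) ltr_nat ltn_sub2l // (leq_trans ab).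
  have := f01 _ bn; have U1 : 1 <= (U b)%:R :> R by rewrite ler1n.
  case: (leqP a o) => [_|oa] /andP[fb0 fb1].
    by apply: (@lt_le_trans _ _ 0); rewrite ?ler0n //; lra.
  have : (U a)%:R <= (U b)%:R :> R by rewrite ler_nat Umono // ltnW.
  have := fmono _ _ ab bn; lra.
move=> i j; rewrite /active /hd /= -/o => oj.
have jn : (pos p j <= n)%N by rewrite -ltnS.
rewrite /pair_hval /hval /lvl /= !mxE /z -/o leqnn subnn leqNgt oj /=.
have /andP[f0 f1] := f01 _ jn.
have -> : 0 - (f (pos p j) - (U (pos p j))%:R) - i.+1%:R =
  (U (pos p j))%:R - i.+1%:R - f (pos p j) by ring.
have -> : ideal false p S i j = (U (pos p j) <= i.+1)%N.
  by rewrite UP.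
have [Ui|iU] := leqP (U (pos p j)) i.+1.
  have : (U (pos p j))%:R <= i.+1%:R :> R by rewrite ler_nat.
  by move=> h; split; [apply/eqP; lra|apply/idP; lra].
have : i.+2%:R <= (U (pos p j))%:R :> R by rewrite ler_nat.
rewrite -[i.+2]addn1 natrD => h.
by split; [apply/eqP; lra|apply/negbTE; rewrite -leNgt; lra].
Qed.

Lemma realize s p S : exists2 x : vec, ordered p x & forall i j, active s p i j ->
  pair_hval s i j x != 0 /\ (pair_hval s i j x < 0) = ideal s p S i j.
Proof. by case: s; [exact: realize_shi|exact: realize_ish]. Qed.
End Realization.

(** * Ceiling diagrams *)

Section RegionDiagrams.
Variables (R : realType) (n : nat).
Notation lab := 'I_n.+1.
Notation vec := 'rV[R]_n.+1.
Implicit Types (s : bool) (p q : 'S_n.+1) (x y z : vec) (i j a b : lab)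
  (G M S : {set lab * lab}).

Definition triples s G : seq (lab * lab * R) :=
  [seq (u.1, u.2, 0) | u <- enum (complete_graph n)] ++
  [seq (hd s u.1, u.2, lvl R s u.1) | u <- enum G].

Lemma triplesP s G t : reflect
  ((exists i j, (i < j)%N /\ t = (i, j, 0)) \/
   (exists i j, (i, j) \in G /\ t = (hd s i, j, lvl R s i))) (t \in triples s G).
Proof.
rewrite mem_cat; apply: (iffP orP) => -[].
- by move/mapP => [[i j]]; rewrite mem_enum inE /= => ij ->; left; exists i, j.
- by move/mapP => [[i j]]; rewrite mem_enum /= => ij ->; right; exists i, j.
- move=> [i [j [ij ->]]]; left; apply/mapP; exists (i, j) => //.
  by rewrite mem_enum inE.
- move=> [i [j [ij ->]]]; right; apply/mapP; exists (i, j) => //.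
  by rewrite mem_enum.
Qed.

Lemma arr_triples s G : @arr R n s G = arrangement (triples s G).
Proof.
apply/seteqP; split=> [H HA|H [t /triplesP tT ->]].
  have h : (exists i j, (i < j)%N /\ H = hyp i j 0) \/
     (exists i j, (i, j) \in G /\ H = hyp (hd s i) j (lvl R s i)).
    by move: HA; rewrite /arr /hd /lvl; case: s => -[h|h]; [left|right|left|right].
  case: h => -[i [j [ij ->]]].
    by exists (i, j, 0) => //; apply/triplesP; left; exists i, j.
  by exists (hd s i, j, lvl R s i) => //; apply/triplesP; right; exists i, j.
case: tT => -[i [j [ij ->]]]; rewrite /arr /=.
  by case: s; left; exists i, j.
by case: s; right; exists i, j.
Qed.

Lemma triples_wf s G : is_graph G -> wf_triples (triples s G).
Proof.
move=> hG t /triplesP[] [i [j [ij ->]]] /=; split=> //.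
- by rewrite -val_eqE /= ltn_eqF.
- exact: hd_neq (hG _ _ ij).
- exact/ltW/lvl_gt0.
Qed.

Lemma triple_inj s i j i' j' :
  (hd s i, j, lvl R s i) = (hd s i', j', lvl R s i') -> (i, j) = (i', j').
Proof.
rewrite /hd /lvl; case: s; first by move=> [-> ->].
by move=> [-> /eqP]; rewrite eqr_nat eqSS => /eqP/val_inj ->.
Qed.

Lemma triples_inj s G i j : (hd s i, j, lvl R s i) \in triples s G -> (i, j) \in G.
Proof.
case/triplesP => -[i' [j' [ij']]]; last by move/triple_inj => ->.
by move=> [_ _ e]; have := lvl_gt0 R s i; rewrite e ltxx.
Qed.

Lemma ordered_braid p x y : ordered p x ->
  (forall i j, (i < j)%N -> 0 < hval (i, j, 0) x * hval (i, j, 0) y) -> ordered p y.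
Proof.
move=> px xy a b ab; have xab := px _ _ ab.
have pab : p a != p b by apply/eqP => /perm_inj e; rewrite e ltnn in ab.
have [lt|] := ltnP (p a) (p b).
  by have := xy _ _ lt; rewrite /hval /= !subr0 pmulr_rgt0 subr_gt0.
rewrite leq_eqVlt => /orP[/eqP/val_inj e|lt]; first by rewrite e eqxx in pab.
by have := xy _ _ lt; rewrite /hval /= !subr0 nmulr_rgt0 ?subr_lt0.
Qed.

Lemma ordered_cell s G p x y : ordered p x -> cell (triples s G) x y -> ordered p y.
Proof.
move=> px xy; apply: (ordered_braid px) => i j ij.
by apply: xy; apply/triplesP; left; exists i, j.
Qed.

Lemma generic_ordered s G x : generic (triples s G) x -> exists p, ordered p x.
Proof.
move=> gx; apply: exists_ordered => i j ij; rewrite -subr_eq0.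
have [lt|] := ltnP i j.
  have : (i, j, 0) \in triples s G by apply/triplesP; left; exists i, j.
  by move/gx; rewrite /hval /= subr0.
rewrite leq_eqVlt => /orP[/eqP/val_inj e|lt]; first by rewrite e eqxx in ij.
have : (j, i, 0) \in triples s G by apply/triplesP; left; exists j, i.
by move/gx; rewrite /hval /= subr0 -opprB oppr_eq0.
Qed.

(** Only active pairs have to be compared: the common order settles the braid hyperplanes, and
    inactive pairs are negative on the whole cone. *)
Lemma cell_ordered s G p x y : is_graph G -> generic (triples s G) x ->
  ordered p x -> ordered p y ->
  (forall i j, (i, j) \in G -> active s p i j -> pair_hval s i j y != 0 /\
    (pair_hval s i j x < 0) = (pair_hval s i j y < 0)) ->
  cell (triples s G) x y.
Proof.
move=> hG gx px py xy t tT; have tx := gx _ tT.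
have side : hval t y != 0 -> (hval t x < 0) = (hval t y < 0) -> 0 < hval t x * hval t y.
  move=> ty; case: (ltgtP (hval t x) 0) tx => // hx _; case: (ltgtP (hval t y) 0) ty => // hy _ _.
    by rewrite nmulr_rgt0.
  by rewrite pmulr_rgt0.
move: side; case/triplesP: tT => -[i [j [ij ->]]]; last first.
  move=> side; have [ac|nac] := boolP (active s p i j); first by have [] := xy _ _ ij ac.
  have ij' := hG _ _ ij.
  by rewrite nmulr_rgt0; apply: hval_inactive nac.
rewrite /hval /= !subr0; apply.
  rewrite subr_eq0; apply/eqP => e; move: (ordered_lt i j py) (ordered_lt j i py).
  rewrite e ltxx; case: (ltngtP (pos p i) (pos p j)) => // /val_inj/pos_inj e'.
  by rewrite e' ltnn in ij.
by rewrite !subr_lt0 (ordered_lt _ _ px) (ordered_lt _ _ py).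
Qed.

(** The last clause says that [M] is an antichain for the order underlying [ideal]. *)
Definition okdiag s G p M :=
  [/\ M \subset G, forall i j, (i, j) \in M -> active s p i j
    & forall i j i' j', (i, j) \in M -> (i', j') \in M ->
        (key s p i' <= key s p i)%N -> (pos p j <= pos p j')%N ->
        (i, j) = (i', j')].

(** The side condition determines the region; the ceiling condition ties [M] to the facets of its
    closure. *)
Definition has_diag s G (C : set vec) p M :=
  [/\ regions (arr s G) C, forall x, C x -> ordered p x,
      (forall x, C x -> forall i j, (i, j) \in G -> active s p i j ->
        (pair_hval s i j x < 0) = ideal s p M i j)
    & forall i j, is_ceiling C (hyp (hd s i) j (lvl R s i)) <-> (i, j) \in M].

Lemma ideal_self s p M i j : (i, j) \in M -> ideal s p M i j.
Proof. by move=> ijM; apply/exists_inP; exists (i, j); rewrite //= !leqnn. Qed.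

Definition maxs s p S : {set lab * lab} :=
  [set u in S | [forall v in S,
     (key s p v.1 <= key s p u.1)%N && (pos p u.2 <= pos p v.2)%N ==> (v == u)]]%SET.

Lemma ideal_maxs s p S i j : (i, j) \in S -> ideal s p (maxs s p S) i j.
Proof.
pose above (u : lab * lab) :=
  (u \in S) && ((key s p u.1 <= key s p i)%N && (pos p j <= pos p u.2)%N).
move=> ijS; have ab0 : above (i, j) by rewrite /above ijS !leqnn.
(* [f] increases strictly along the order, so a maximizer of [f] above [(i, j)] is a maximal element
   of [S]. *)
pose f (u : lab * lab) := (pos p u.2 + (n.+1 - key s p u.1))%N.
have keyn k : (key s p k <= n.+1)%N by rewrite /key; case: s {above ab0 f} => /=; rewrite ltnW.
case: (arg_maxnP f ab0) => u /and3P[uS u1 u2] umax.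
apply/exists_inP; exists u; last by rewrite u1 u2.
rewrite inE uS; apply/forall_inP => v vS; apply/implyP => /andP[v1 v2].
have : (f v <= f u)%N by apply: umax; rewrite /above vS (leq_trans v1) // (leq_trans u2).
have arith (k k' l l' m : nat) : (k' <= k)%N -> (l <= l')%N -> (k <= m)%N ->
    (l' + (m - k') <= l + (m - k))%N -> k' = k /\ l' = l by lia.
rewrite /f => /(arith _ _ _ _ _ v1 v2 (keyn _)) [e1 /val_inj e2].
by move: e1 e2 => /key_inj e1 /pos_inj e2; rewrite (surjective_pairing v) e1 e2 -surjective_pairing.
Qed.

(** By [hval_le] the active pairs on the side of the origin form an ideal [I]; the diagram consists
    of the order of the coordinates and the maximal pairs of [I]. *)
Lemma region_diag s G x : is_graph G -> generic (triples s G) x ->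
  exists p M, okdiag s G p M /\ has_diag s G (cell (triples s G) x) p M.
Proof.
move=> hG gx; have [p px] := generic_ordered gx.
pose I : {set lab * lab} :=
  [set u in G | active s p u.1 u.2 && (pair_hval s u.1 u.2 x < 0)]%SET.
have inI i j : ((i, j) \in I) = [&& (i, j) \in G, active s p i j & pair_hval s i j x < 0].
  by rewrite inE.
have maxE i j i' j' : (i, j) \in maxs s p I -> (i', j') \in I ->
    (key s p i' <= key s p i)%N -> (pos p j <= pos p j')%N -> (i, j) = (i', j').
  rewrite inE => /andP[_ /forall_inP h] ijI' k l; have := h _ ijI'.
  by rewrite /= k l => /eqP ->.
have idealE i j : (i, j) \in G -> active s p i j ->
    (pair_hval s i j x < 0) = ideal s p (maxs s p I) i j.
  move=> ijG ac; apply/idP/exists_inP => [lt|[m]].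
    by apply/exists_inP/ideal_maxs; rewrite inI ijG ac.
  rewrite inE => /andP[]; case: m => k l; rewrite inI => /and3P[_ _ lt] _ /andP[/= k1 l1].
  by apply: le_lt_trans lt; exact: hval_le px _ _.
exists p, (maxs s p I); split.
  split.
  - by apply/fintype.subsetP => u; rewrite !inE => /andP[/andP[]].
  - by move=> i j; rewrite inE inI => /andP[/and3P[]].
  - move=> i j i' j' ijM ijM'; apply: maxE => //.
    by move: ijM'; rewrite inE => /andP[].
have T0 i j : (i, j) \in G -> (hd s i, j, lvl R s i) \in triples s G.
  by move=> ijG; apply/triplesP; right; exists i, j.
split.
- by rewrite arr_triples; apply/arrangement_regionsE; exists x.
- by move=> y; exact: ordered_cell.
- move=> y xy i j ijG ac; rewrite -idealE //.
  have := xy _ (T0 _ _ ijG); rewrite -!/(pair_hval _ _ _ _).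
  case: (ltgtP (pair_hval s i j x) 0) => h; last by rewrite h mul0r ltxx.
    by rewrite nmulr_rgt0.
  by rewrite pmulr_rgt0 // => h'; apply/negbTE; rewrite -leNgt ltW.
move=> i j; rewrite (ceilingP _ _ (triples_wf hG) gx (lvl_gt0 R s i)).
split=> [[/triples_inj ijG lt [y y0 yT]]|ijM].
  have same i' j' : (i', j') \in G -> (i', j') != (i, j) ->
      0 < pair_hval s i' j' x * pair_hval s i' j' y.
    by move=> ijG' ne; apply: yT; [exact: T0|apply: contra ne => /eqP/triple_inj ->].
  have py : ordered p y.
    apply: (ordered_braid px) => i' j' ij'; apply: yT.
      by apply/triplesP; left; exists i', j'.
    by apply/eqP => -[_ _ e]; have := lvl_gt0 R s i; rewrite -e ltxx.
  have ac : active s p i j.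
    apply: contraT => /(hval_inactive (hG _ _ ijG) py).
    by rewrite /pair_hval y0 ltxx.
  rewrite inE inI ijG ac; apply/andP; split; first exact: lt.
  apply/forall_inP => -[k l]; rewrite inI /= => /and3P[klG klac kllt].
  apply/implyP => /andP[k1 l1]; apply: contraT => ne.
  (* A larger pair of [I] is strictly negative at [y], which by [hval_le] contradicts the value 0 of
     [(i, j)] there. *)
  have := same _ _ klG ne; rewrite (nmulr_rgt0 _ kllt) => kly.
  by have := le_lt_trans (hval_le py k1 l1) kly; rewrite /pair_hval y0 ltxx.
have /and3P[ijG ac lt] : [&& (i, j) \in G, active s p i j & pair_hval s i j x < 0].
  by rewrite -inI; move: ijM; rewrite inE => /andP[].
(* A maximal pair is a ceiling: the segment from [x] to a point realizing the
   ideal without that pair crosses no other hyperplane. *)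
have [x' px' x'P] := realize R s p (I :\ (i, j))%SET.
have x'gt : 0 < pair_hval s i j x'.
  have [ne] := x'P _ _ ac; case: (ltgtP (pair_hval s i j x') 0) ne => // _ _.
  move=> /esym/exists_inP [[k l]]; rewrite in_setD1 => /andP[ne klI] /andP[k1 l1].
  by rewrite (maxE _ _ _ _ ijM klI k1 l1) eqxx in ne.
set G' := (G :\ (i, j))%SET.
have hG' : is_graph G' by move=> k l; rewrite in_setD1 => /andP[_]; exact: hG.
have sub t : t \in triples s G -> t != (hd s i, j, lvl R s i) -> t \in triples s G'.
  move=> /triplesP[] [k [l [kl ->]]] ne; apply/triplesP; first by left; exists k, l.
  right; exists k, l; split=> //; rewrite in_setD1 kl andbT.
  by apply: contra ne => /eqP[-> ->].
have sub' t : t \in triples s G' -> t \in triples s G.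
  move=> /triplesP[] [k [l [kl ->]]]; apply/triplesP; [left|right]; exists k, l; split=> //.
  by move: kl; rewrite in_setD1 => /andP[].
have gx' : generic (triples s G') x by move=> t /sub'; exact: gx.
have xx' : cell (triples s G') x x'.
  apply: (cell_ordered hG' gx' px px') => k l; rewrite in_setD1 => /andP[ne klG] klac.
  have [ne0 ->] := x'P _ _ klac; split=> //.
  apply/idP/exists_inP => [kllt|[[u v]]].
    by exists (k, l); rewrite ?leqnn // in_setD1 ne inI klG klac.
  rewrite in_setD1 inI => /andP[_ /and3P[_ _ uvlt]] /andP[u1 v1].
  exact: le_lt_trans (hval_le px u1 v1) uvlt.
split; [exact: T0|exact: lt|].
set u := pair_hval s i j x in lt; set v := pair_hval s i j x' in x'gt.
have vu : 0 < v - u by lra.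
(* The zero of the affine function going from [v > 0] at [x'] to [u < 0] at [x]. *)
exists (x' + (v / (v - u)) *: (x - x')).
  by rewrite hval_conv -/(pair_hval _ _ _ _) -/(pair_hval _ _ _ _) -/u -/v; field; rewrite gt_eqF.
move=> t tT ne; rewrite mul_hval_conv.
have l0 : 0 < v / (v - u) by rewrite divr_gt0.
apply: conv_gt0; rewrite ?l0 //.
- by rewrite ltW //= ler_pdivrMr // mul1r; lra.
- by apply/ltW/xx'/sub.
- exact: (generic_cell gx).
Qed.

(** A pair of [M] lies below one of [M'], which lies below one of [M]; the antichain property forces
    all three to coincide. *)
Lemma antichain_ideal_sub s G p M M' : okdiag s G p M -> okdiag s G p M' ->
  (forall i j, (i, j) \in G -> active s p i j -> ideal s p M i j = ideal s p M' i j) ->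
  M \subset M'.
Proof.
move=> [/fintype.subsetP MG Mac Manti] [/fintype.subsetP M'G M'ac _] e.
apply/fintype.subsetP => -[i j] ijM.
have := ideal_self s p ijM; rewrite e ?Mac ?MG // => /exists_inP[[k l] klM' /andP[/= k1 l1]].
have := ideal_self s p klM'; rewrite -e ?M'ac ?M'G // => /exists_inP[[u v] uvM /andP[/= u1 v1]].
have [e1 e2] := Manti _ _ _ _ ijM uvM (leq_trans u1 k1) (leq_trans l1 v1).
subst u v; have -> : i = k by apply: (@key_inj _ s p); apply/eqP; rewrite eqn_leq u1 k1.
by have -> : j = l by apply: (@pos_inj _ p); apply/val_inj/eqP; rewrite /= eqn_leq l1 v1.
Qed.

Lemma has_diag_exists s G (C : set vec) : is_graph G -> regions (arr s G) C ->
  exists p M, okdiag s G p M /\ has_diag s G C p M.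
Proof.
move=> hG; rewrite arr_triples => /arrangement_regionsE [x gx ->].
exact: region_diag.
Qed.

Lemma region_nonempty s G (C : set vec) : regions (arr s G) C -> C !=set0.
Proof.
rewrite arr_triples => /arrangement_regionsE [x gx ->]; exists x.
exact: generic_cell.
Qed.

Lemma has_diag_uniq s G G' (C : set vec) p M p' M' :
  has_diag s G C p M -> has_diag s G' C p' M' -> p = p' /\ M = M'.
Proof.
move=> [Creg Cp _ CM] [_ Cp' _ CM']; split.
  have [x Cx] := region_nonempty Creg.
  exact: ordered_inj (Cp _ Cx) (Cp' _ Cx).
by apply/finset.setP => -[i j]; apply/idP/idP => [/CM|/CM'] h; [apply/CM'|apply/CM].
Qed.

(** The cell of a point realizing the ideal of [M] has some diagram; its antichain generates the
    same ideal, hence equals [M]. *)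
Lemma realize_diag s G p M : is_graph G -> okdiag s G p M ->
  exists C, has_diag s G C p M.
Proof.
move=> hG okM; have [x px xP] := realize R s p M.
have gx : generic (triples s G) x.
  move=> t /triplesP[] [i [j [ij ->]]].
    rewrite /hval /= subr0 subr_eq0; apply/eqP => e.
    move: (ordered_lt i j px) (ordered_lt j i px); rewrite e ltxx.
    case: (ltngtP (pos p i) (pos p j)) => // /val_inj/pos_inj e'.
    by rewrite e' ltnn in ij.
  have [ac|nac] := boolP (active s p i j); first by have [] := xP _ _ ac.
  by rewrite lt_eqF //; exact: (hval_inactive (hG _ _ ij) px nac).
exists (cell (triples s G) x).
have [p' [M' [okM' dM']]] := region_diag hG gx.
have xx := generic_cell gx.
have e : p' = p by case: dM' => _ h _ _; exact: ordered_inj (h _ xx) px.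
subst p'; suff -> : M = M' by [].
have eq i j : (i, j) \in G -> active s p i j -> ideal s p M i j = ideal s p M' i j.
  by move=> ijG ac; case: dM' => _ _ /(_ _ xx) <- // _; have [_ ->] := xP _ _ ac.
apply/eqP; rewrite finset.eqEsubset; apply/andP; split.
  exact: antichain_ideal_sub okM okM' eq.
by apply: antichain_ideal_sub okM' okM _ => i j ijG ac; rewrite eq.
Qed.

Lemma has_diag_inj s G (C C' : set vec) p M : is_graph G ->
  has_diag s G C p M -> has_diag s G C' p M -> C = C'.
Proof.
move=> hG [Creg Cp CM _] [C'reg C'p C'M _].
move: Creg C'reg Cp CM C'p C'M; rewrite arr_triples.
move=> /arrangement_regionsE [x gx ->] /arrangement_regionsE [x' gx' ->] Cp CM C'p C'M.
have xx := generic_cell gx; have xx' := generic_cell gx'.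
have h : cell (triples s G) x x'.
  apply: (cell_ordered hG gx (Cp _ xx) (C'p _ xx')) => i j ijG ac; split.
    by apply: gx'; apply/triplesP; right; exists i, j.
  by rewrite (CM _ xx) // (C'M _ xx').
have same (a b c : R) : 0 < a * b -> (0 < a * c) = (0 < b * c).
  move=> ab; have a0 : a != 0 by apply: contraTneq ab => ->; rewrite mul0r ltxx.
  case: (ltgtP a 0) a0 ab => // a0 _; rewrite ?(nmulr_rgt0 _ a0) ?(pmulr_rgt0 _ a0) => b0.
    by rewrite (nmulr_rgt0 _ b0).
  by rewrite (pmulr_rgt0 _ b0).
by apply/seteqP; split=> y yC t tT; have := yC _ tT; rewrite (same _ _ _ (h _ tT)).
Qed.
End RegionDiagrams.

(** * Words of diagrams *)

Lemma connect_first (T : finType) (e : rel T) x y : connect e x y ->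
  x = y \/ exists2 z, e x z & connect e z y.
Proof.
move=> /connectP [[|z c] /= ec ->]; first by left.
by move: ec => /andP[xz zc]; right; exists z => //; apply/connectP; exists c.
Qed.

Lemma connect_last (T : finType) (e : rel T) x y : connect e x y ->
  x = y \/ exists2 z, connect e x z & e z y.
Proof.
move=> /connectP [c]; case/lastP: c => [|c z] /=; first by move=> _ ->; left.
rewrite rcons_path last_rcons => /andP[xc cz] ->; right.
by exists (last x c) => //; apply/connectP; exists c.
Qed.

(** A relation that is injective and functional branches in neither direction, so a step against the
    current direction only retraces the walk. *)
Lemma connect_sym_closure (T : finType) (e : rel T) :
  (forall x y z, e x y -> e x z -> y = z) -> (forall x y z, e x z -> e y z -> x = y) ->
  forall x y, connect (fun a b => e a b || e b a) x y = connect e x y || connect e y x.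
Proof.
move=> efun einj x y; apply/idP/orP => [|[]]; last 2 first.
- by apply: connect_sub => a b ab; apply: connect1; rewrite ab.
- rewrite (@sym_connect_sym _ (fun a b => e a b || e b a)); last by move=> a b; rewrite /= orbC.
  by apply: connect_sub => a b ab; apply: connect1; rewrite ab.
move=> /connectP [c]; elim/last_ind: c y => [|c z IH] y /=; first by move=> _ ->; left.
rewrite rcons_path last_rcons => /andP[xc cz] ->; case: (IH _ xc erefl) => h.
  case/orP: cz => cz; first by left; apply: connect_trans h (connect1 cz).
  case: (connect_last h) => [->|[u xu uc]]; first by right; exact: connect1.
  by left; rewrite (einj _ _ _ cz uc).
case/orP: cz => cz; last by right; apply: connect_trans (connect1 cz) h.
case: (connect_first h) => [<-|[u cu ux]]; first by left; exact: connect1.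
by right; rewrite (efun _ _ _ cz cu).
Qed.

Section Words.
Variable n : nat.
Notation lab := 'I_n.+1.
Notation word := {ffun lab -> nat}.
Notation K := (complete_graph n).
Implicit Types (s : bool) (p q : 'S_n.+1) (i j a b : lab)
  (G M S : {set lab * lab}) (w : word).

Definition is_root M j := forall i, (i, j) \notin M.

Definition word_of p M w :=
  (forall i j, (i, j) \in M -> w j = w i) /\
  (forall j, is_root M j -> w j = (pos p j).+1).

Definition arcs w : {set lab * lab} :=
  [set u : lab * lab | [&& (u.1 < u.2)%N, w u.1 == w u.2 &
    [forall k : lab, (u.1 < k < u.2)%N ==> (w k != w u.1)]]]%SET.

(** The properties characterizing the arc sets of set partitions. *)
Definition chains M :=
  [/\ forall i j, (i, j) \in M -> (i < j)%N,
      forall i j j', (i, j) \in M -> (i, j') \in M -> j = j'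
    & forall i i' j, (i, j) \in M -> (i', j) \in M -> i = i'].

Notation mrel M := (fun i j => (i, j) \in M).

Lemma okdiag_chains s p M : okdiag s K p M -> chains M.
Proof.
move=> [/fintype.subsetP MK _ anti]; split.
- by move=> i j /MK; rewrite inE.
- move=> i j j' ij ij'; case: (leqP (pos p j) (pos p j')) => h.
    by have [] := anti _ _ _ _ ij ij' (leqnn _) h.
  by have [] := anti _ _ _ _ ij' ij (leqnn _) (ltnW h).
- move=> i i' j ij ij'; case: (leqP (key s p i') (key s p i)) => h.
    by have [] := anti _ _ _ _ ij ij' h (leqnn _).
  by have [] := anti _ _ _ _ ij' ij (ltnW h) (leqnn _).
Qed.

Lemma okdiag_lt s p M i j i' j' : okdiag s K p M -> (i, j) \in M -> (i', j') \in M ->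
  (pos p j < pos p j')%N -> (key s p i < key s p i')%N.
Proof.
move=> [_ _ anti] ij ij' lt; rewrite ltnNge; apply/negP => le.
by have [_ e] := anti _ _ _ _ ij ij' le (ltnW lt); rewrite e ltnn in lt.
Qed.

Lemma chains_connect_leq M i j : chains M -> connect (mrel M) i j -> (i <= j)%N.
Proof.
move=> [Mlt _ _] /connectP [c]; elim: c i => [|k c IH] i /=; first by move=> _ ->.
by move=> /andP[/Mlt ik kc] jE; apply: leq_trans (ltnW ik) (IH _ kc jE).
Qed.

Lemma root_exists M j : chains M -> exists2 r, is_root M r & connect (mrel M) r j.
Proof.
move=> [Mlt _ _]; have [m] := ubnP (j : nat); elim: m j => // m IH j; rewrite ltnS => jm.
have [/existsP[i ij]|/existsPn jr] := boolP [exists i, (i, j) \in M]; last by exists j.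
have [r rr ri] := IH i (leq_trans (Mlt _ _ ij) jm).
by exists r => //; apply: connect_trans ri (connect1 ij).
Qed.

Lemma word_of_connect p M w i j : word_of p M w -> connect (mrel M) i j -> w j = w i.
Proof.
move=> [wM _] /connectP [c]; elim: c i => [|k c IH] i /=; first by move=> _ ->.
by move=> /andP[/wM <- kc] jE; exact: IH.
Qed.

Lemma word_of_root p M w j : chains M -> word_of p M w ->
  exists r, [/\ is_root M r, connect (mrel M) r j & w j = (pos p r).+1].
Proof.
move=> chM wM; have [r rr rj] := root_exists j chM; exists r; split => //.
by rewrite (word_of_connect wM rj); case: wM => _ ->.
Qed.

(** Distinct roots have distinct positions, so equal letters come from the same root, and a root
    starts a single chain. *)
Lemma word_of_eq p M w i j : chains M -> word_of p M w -> w i = w j ->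
  connect (mrel M) i j \/ connect (mrel M) j i.
Proof.
move=> chM wM wij.
have [r [rr ri wi]] := word_of_root i chM wM.
have [r' [rr' rj wj]] := word_of_root j chM wM.
have rE : r = r'.
  by apply: (@pos_inj _ p); apply/val_inj; move: wij; rewrite wi wj => -[].
subst r'; have [_ Mfun Minj] := chM; apply/orP.
rewrite -(connect_sym_closure Mfun Minj); apply: (@connect_trans _ _ r).
  by rewrite (connect_sym_closure Mfun Minj) ri orbT.
by rewrite (connect_sym_closure Mfun Minj) rj.
Qed.

(** Labels with equal letters lie on one increasing chain of [M], and neighbours on it are joined by
    a pair of [M]. *)
Lemma arcs_word_of p M w : chains M -> word_of p M w -> arcs w = M.
Proof.
move=> chM wM; have [Mlt Mfun Minj] := chM; have [wE _] := wM.
apply/finset.setP => -[i j]; rewrite inE /=; apply/and3P/idP => [[ij /eqP wij /forallP btw]|ijM].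
  have [ij'|/(chains_connect_leq chM)] := word_of_eq chM wM wij; last by rewrite leqNgt ij.
  have [e|[k ik kj]] := connect_first ij'; first by rewrite e ltnn in ij.
  have := btw k; rewrite (Mlt _ _ ik) (wE _ _ ik) eqxx implybF -leqNgt => jk.
  suff -> : j = k by [].
  by apply/val_inj/eqP; rewrite eqn_leq jk; exact: chains_connect_leq chM kj.
split; [exact: Mlt|by rewrite (wE _ _ ijM)|].
apply/forallP => k; apply/implyP => /andP[ik kj]; apply/eqP => wki.
have [/(chains_connect_leq chM)|ik'] := word_of_eq chM wM wki; first by rewrite leqNgt ik.
have [e|[l il lk]] := connect_first ik'; first by rewrite e ltnn in ik.
have := chains_connect_leq chM lk; rewrite -(Mfun _ _ _ ijM il) leqNgt.
by rewrite kj.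
Qed.

Lemma word_of_inj s p M p' M' w : okdiag s K p M -> okdiag s K p' M' ->
  word_of p M w -> word_of p' M' w -> p = p' /\ M = M'.
Proof.
move=> ok ok' wM wM'.
have ME : M = M'.
  rewrite -(arcs_word_of (okdiag_chains ok) wM).
  by rewrite -(arcs_word_of (okdiag_chains ok') wM').
(* At the first position [a] where [p] and [p'] differ, neither label is a
   root, and the keys of the two predecessors compare in opposite ways. *)
subst M'; split => //; apply/permP => a.
have [m] := ubnP (a : nat); elim: m a => // m IHm a; rewrite ltnS => am.
have IH b : (b < a)%N -> p b = p' b by move=> ba; apply: IHm; exact: leq_trans ba am.
have rootE j : is_root M j -> pos p j = pos p' j.
  case: wM => _ h /[dup] /h e; case: wM' => _ h' /h' e'.
  by apply/val_inj; move: e; rewrite e' => -[].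
have agree j : (pos p j < a)%N -> pos p' j = pos p j.
  by move=> /IH; rewrite posK => {1}->; rewrite permposK.
have agree' j : (pos p' j < a)%N -> pos p j = pos p' j.
  by move=> /IH; rewrite posK => {1}<-; rewrite permposK.
have [/existsP[q qi]|/existsPn ri] := boolP [exists q, (q, p a) \in M]; last first.
  by have := rootE _ ri; rewrite permposK => e; rewrite [in RHS]e posK.
have [/existsP[q' qi']|/existsPn ri'] := boolP [exists q, (q, p' a) \in M]; last first.
  by have := rootE _ ri'; rewrite permposK => e; rewrite -[in LHS]e posK.
apply/eqP; apply: contraT => /eqP ne.
have lt : (pos p (p a) < pos p (p' a))%N.
  rewrite permposK ltnNge leq_eqVlt; apply/negP => /orP[/eqP/val_inj e|h].
    by case: ne; rewrite -[in LHS]e posK.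
  by have := agree _ h; rewrite permposK => e; rewrite -e ltnn in h.
have lt' : (pos p' (p' a) < pos p' (p a))%N.
  rewrite permposK ltnNge leq_eqVlt; apply/negP => /orP[/eqP/val_inj e|h].
    by case: ne; rewrite -[in RHS]e posK.
  by have := agree' _ h; rewrite permposK => e; rewrite -e ltnn in h.
have := okdiag_lt ok qi qi' lt; have := okdiag_lt ok' qi' qi lt'.
case: ok ok' => _ ac _ [_ ac' _]; have := ac _ _ qi; have := ac' _ _ qi'.
rewrite /active /key /hd; case: (s) => [|_ _ h h']; last first.
  by move: (ltn_trans h h'); rewrite ltnn.
(* In the Shi case the keys are positions; both predecessors stand before position [a], where [p]
   and [p'] agree. *)
rewrite !permposK => /agree' -> /agree -> h h'.
by move: (ltn_trans h h'); rewrite ltnn.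
Qed.

Lemma word_of_range p M w i : chains M -> word_of p M w -> (1 <= w i <= n.+1)%N.
Proof.
by move=> chM wM; have [r [_ _ ->]] := word_of_root i chM wM; rewrite /= ltn_ord.
Qed.

(** Label 1 is a root. An active Ish pair has its second label after label 1, so every position
    before label 1 holds a root and contributes its own letter. *)
Lemma word_of_rook p M w : okdiag false K p M -> word_of p M w -> rook_word w.
Proof.
move=> ok wM; have chM := okdiag_chains ok; split=> [i|k /andP[k1 kw]].
  exact: word_of_range chM wM.
have [Mlt _ _] := chM; have [_ wr] := wM.
have r0 : is_root M ord0 by move=> i; apply/negP => /Mlt.
move: kw; rewrite wr // => kw; case: k k1 kw => // k _; rewrite ltnS => kw.
have kn : (k < n.+1)%N by exact: leq_ltn_trans kw (ltn_ord _).
exists (p (Ordinal kn)); rewrite wr ?permposK // => i; apply/negP => iM.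
case: ok => _ /(_ _ _ iM); rewrite /active /hd permposK /= ltnNge.
by rewrite kw.
Qed.

Lemma word_of_shi_le p M w i : okdiag true K p M -> word_of p M w -> (w i <= (pos p i).+1)%N.
Proof.
move=> ok wM; have chM := okdiag_chains ok.
have [r [_ /connectP[c]]] := word_of_root i chM wM.
move=> ci ic ->; rewrite ltnS; case: ok => _ ac _.
elim: c r ci ic => [|k c IH] r /=; first by move=> _ ->.
by move=> /andP[/ac rk kc] ic; apply: leq_trans (ltnW rk) (IH _ kc ic).
Qed.
End Words.

(** * The diagram of a parking function or a rook word *)

Lemma nth_sorted_leq (s : seq nat) i v : sorted leq s -> (i < size s)%N ->
  (nth 0 s i <= v)%N = (i < count (fun x => x <= v) s)%N.
Proof.
elim: s i => // x s IH i /= xs; have ss := path_sorted xs.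
have all0 : (v < x)%N -> count (fun y => y <= v)%N s = 0%N.
  move=> vx; apply/eqP; rewrite eqn0Ngt -has_count; apply/negP => /hasP[y ys yv].
  have := order_path_min leq_trans xs => /allP/(_ _ ys) xy.
  by have := leq_trans (leq_ltn_trans yv vx) xy; rewrite ltnn.
case: i => [_|i] /=; first by case: (leqP x v) => //= /all0 ->.
rewrite ltnS => /(IH _ ss) ->; case: (leqP x v) => //= /all0 ->.
by rewrite !ltn0.
Qed.

Lemma parkingP n (w : {ffun 'I_n.+1 -> nat}) : parking w <->
  in_range n.+1 w /\ forall k, (k <= n.+1)%N -> (k <= #|[set i | (w i <= k)%N]%SET|)%N.
Proof.
have cnt k : count (fun x => x <= k)%N (sort leq (codom w)) = #|[set i | (w i <= k)%N]%SET|.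
  rewrite (seq.permP (permEl (perm_sort _ _))) codomE count_map cardE size_filter.
  by rewrite enumT; apply: eq_count => i; rewrite !inE.
have sz : size (sort leq (codom w)) = n.+1 by rewrite size_sort size_codom card_ord.
have srt : sorted leq (sort leq (codom w)) by apply: sort_sorted; exact: leq_total.
split=> -[wr h]; split => //.
  case=> // k kn; rewrite -cnt -nth_sorted_leq ?sz //.
  exact: (h (Ordinal kn)).
by move=> i; rewrite nth_sorted_leq ?sz // cnt h.
Qed.

Lemma index_pmap_le (T U : eqType) (f : T -> option U) (l : seq T) i j i' j' :
  (forall x y z, f x = Some z -> f y = Some z -> x = y) ->
  f i = Some j -> f i' = Some j' -> (index i' l <= index i l)%N ->
  (index j' (pmap f l) <= index j (pmap f l))%N.
Proof.
move=> finj fi fi'; elim: l => //= x l IH.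
have [->|xi'] := eqVneq x i'; first by rewrite fi' /= eqxx.
have [->|xi] := eqVneq x i; first by [].
rewrite ltnS => /IH; case fx : (f x) => [y|] //=.
have [e|_] := eqVneq y j'; first by rewrite e in fx; rewrite (finj _ _ _ fx fi') eqxx in xi'.
have [e|_] := eqVneq y j; first by rewrite e in fx; rewrite (finj _ _ _ fx fi) eqxx in xi.
by rewrite ltnS.
Qed.

Lemma index_filter_le (T : eqType) (a : pred T) (l : seq T) j j' : a j ->
  (index j l <= index j' l)%N -> (index j [seq x <- l | a x] <= index j' [seq x <- l | a x])%N.
Proof.
move=> aj; elim: l => //= x l IH.
have [->|xj] := eqVneq x j; first by rewrite aj /= eqxx.
have [_|xj'] := eqVneq x j'; first by [].
rewrite ltnS => /IH; case: (a x) => //=.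
by rewrite (negbTE xj) (negbTE xj') ltnS.
Qed.

Section ArcDiagrams.
Variable n : nat.
Notation lab := 'I_n.+1.
Notation word := {ffun lab -> nat}.
Notation K := (complete_graph n).
Implicit Types (s : bool) (p q : 'S_n.+1) (i j : lab) (w : word) (l : seq lab).

Lemma in_arcs w i j : ((i, j) \in arcs w) =
  [&& (i < j)%N, w i == w j & [forall k : lab, (i < k < j)%N ==> (w k != w i)]].
Proof. by rewrite inE. Qed.

Lemma arcs_chains w : chains (arcs w).
Proof.
split=> [i j|i j j'|i i' j]; rewrite !in_arcs; first by case/andP.
- move=> /and3P[ij /eqP wij /forallP h] /and3P[ij' /eqP wij' /forallP h'].
  apply/val_inj; case: (ltngtP j j') => // lt.
    by have := h' j; rewrite ij lt wij eqxx.
  by have := h j'; rewrite ij' lt wij' eqxx.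
- move=> /and3P[ij /eqP wij /forallP h] /and3P[ij' /eqP wij' /forallP h'].
  apply/val_inj; case: (ltngtP i i') => // lt.
    by have := h i'; rewrite ij' lt wij wij' eqxx.
  by have := h' i; rewrite ij lt wij wij' eqxx.
Qed.

Lemma arcs_eq w i j : (i, j) \in arcs w -> w j = w i.
Proof. by rewrite in_arcs => /and3P[_ /eqP]. Qed.

Lemma arcs_root_exists w j : exists2 r, is_root (arcs w) r & w r = w j.
Proof.
have [r rr /connectP[c rc ->]] := root_exists j (arcs_chains w); exists r => //.
elim: c r rc {rr} => //= k c IH r /andP[/arcs_eq <- kc].
exact: IH.
Qed.

(** Otherwise the last label before the later root with the same letter would be its predecessor. *)
Lemma arcs_root_uniq w i j :
  is_root (arcs w) i -> is_root (arcs w) j -> w i = w j -> i = j.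
Proof.
wlog lt : i j / (i < j)%N.
  move=> h ri rj e; case: (ltngtP i j) => [lt|lt|/val_inj //]; first exact: h.
  by apply/esym; apply: h.
move=> _ rj wij; have Pi : (i < j)%N && (w i == w j) by rewrite lt wij eqxx.
case: (@arg_maxnP _ i (fun k : lab => (k < j)%N && (w k == w j)) val Pi).
move=> k /andP[kj /eqP wk] kmax.
suff kj' : (k, j) \in arcs w by have := rj k; rewrite kj'.
rewrite in_arcs kj wk eqxx /=; apply/forallP => m; apply/implyP => /andP[km mj].
by apply: contraL km => wm; rewrite -leqNgt; apply: kmax; rewrite mj.
Qed.

Definition rootb w j := [forall i, (i, j) \notin arcs w].
Definition succ_of w i := [pick j | (i, j) \in arcs w].

Lemma rootbP w j : reflect (is_root (arcs w) j) (rootb w j).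
Proof. exact: forallP. Qed.

Lemma succ_ofP w i j : succ_of w i = Some j <-> (i, j) \in arcs w.
Proof.
rewrite /succ_of; case: pickP => [k ik|none].
  split=> [[<-] //|ij].
  by have [_ h _] := arcs_chains w; rewrite (h _ _ _ ik ij).
by split=> // ij; rewrite none in ij.
Qed.

Lemma succ_of_inj w i i' j : succ_of w i = Some j -> succ_of w i' = Some j -> i = i'.
Proof. by move=> /succ_ofP ij /succ_ofP ij'; have [_ _ h] := arcs_chains w; exact: h ij ij'. Qed.

(* The labels are placed from left to right: position [a] receives the root with
   letter [a.+1] if there is one, and otherwise the first label not yet placed in
   the list of successors, which the key orders by their predecessors. *)
Definition source s l := if s then l else enum lab.
Definition successors s w l := pmap (succ_of w) (source s l).

(** Invariant of the construction: placed roots stand where their letters say, no root is overdue,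
    the placed non-roots are an initial segment of the available successors, and in the Shi case
    predecessors come first. *)
Definition placed s w l :=
  [/\ uniq l, forall j, j \in l -> rootb w j -> w j = (index j l).+1,
      forall j, rootb w j -> (w j <= size l)%N -> j \in l,
      prefix [seq j <- l | ~~ rootb w j] (successors s w l)
    & s -> forall i j, (i, j) \in arcs w -> j \in l -> (index i l < index j l)%N].

Lemma successors_uniq s w l : uniq l -> uniq (successors s w l).
Proof.
move=> ul; apply: (@pmap_uniq _ _ _ (fun j => odflt j [pick i | (i, j) \in arcs w])).
  move=> i; case e : (succ_of w i) => [j|] //=; case: pickP => [k kj|h] /=.
    by apply: succ_of_inj e; apply/succ_ofP.
  by move/succ_ofP: e; rewrite h.
by rewrite /source; case: s => //; exact: enum_uniq.
Qed.

Lemma successors_rcons s w l x : prefix (successors s w l) (successors s w (rcons l x)).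
Proof.
rewrite /successors /source; case: s; last exact: prefix_refl.
by rewrite -cats1 pmap_cat prefix_prefix.
Qed.

(** When no root is due, a successor is still available. Otherwise, in the Shi case all labels with
    letter at most [size l] are placed and too few letters are at most [(size l).+1] for a parking
    function. In the Ish case all [n.+1 - size l] unplaced labels are roots, with distinct letters
    among only [n - size l] values. *)
Lemma placed_size s w l : in_range n.+1 w ->
  (s -> forall k, (k <= n.+1)%N -> (k <= #|[set i | (w i <= k)%N]%SET|)%N) ->
  placed s w l -> (size l <= n)%N -> (forall j, w j != (size l).+1) ->
  (size [seq j <- l | ~~ rootb w j] < size (successors s w l))%N.
Proof.
move=> wr wp [ul lr rl pl _] ln no; rewrite ltnNge; apply/negP => le.
have fE : [seq j <- l | ~~ rootb w j] = successors s w l.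
  move/prefixP: pl => [t e]; move: le.
  rewrite e size_cat -{2}[size _]addn0 leq_add2l leqn0 size_eq0 => /eqP ->.
  by rewrite cats0.
have succ_in i j : (i, j) \in arcs w -> i \in source s l -> j \in l.
  move=> /succ_ofP ij il; have : j \in successors s w l.
    by rewrite mem_pmap -ij map_f.
  by rewrite -fE mem_filter => /andP[].
case: s wp pl fE succ_in le => wp pl fE succ_in le.
  have all_in j : (w j <= size l)%N -> j \in l.
    have [m] := ubnP (j : nat); elim: m j => // m IH j; rewrite ltnS => jm wj.
    have [jr|] := boolP (rootb w j); first exact: rl.
    move=> /forallPn[i]; rewrite negbK => ij; apply: (succ_in i) => //.
    apply: IH; last by rewrite -(arcs_eq ij).
    by have [h _ _] := arcs_chains w; exact: leq_trans (h _ _ ij) jm.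
  have := wp isT (size l).+1; rewrite ltnS => /(_ ln); rewrite ltnNge => /negP; apply.
  apply: leq_trans (card_size l); apply: subset_leq_card; apply/fintype.subsetP => j.
  by rewrite inE leq_eqVlt (negbTE (no j)) ltnS => /all_in.
have root_out j : j \notin l -> rootb w j.
  move=> jl; apply: contraNT jl => /forallPn[i]; rewrite negbK => ij.
  by apply: (succ_in i) => //; rewrite mem_enum.
pose c := [seq j <- enum lab | j \notin l].
have szc : size c = (n.+1 - size l)%N.
  have cE : size c = #|[predC l]|.
    by rewrite cardE /c enumT /enum_mem; congr size; apply: eq_filter => j; rewrite !inE.
  have e : (size l + size c)%N = n.+1 by rewrite cE -(card_uniqP ul) cardC card_ord.
  by apply: (@addnI (size l)); rewrite e subnKC // ltnW.
have uc : uniq [seq w j | j <- c].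
  rewrite map_inj_in_uniq; first exact/filter_uniq/enum_uniq.
  move=> i j.
  rewrite !mem_filter => /andP[/root_out/rootbP ri _] /andP[/root_out/rootbP rj _].
  exact: arcs_root_uniq.
have sub : {subset [seq w j | j <- c] <= iota (size l).+2 (n - size l)}.
  move=> k /mapP[j]; rewrite mem_filter => /andP[jl _] ->; rewrite mem_iota.
  have /andP[_ wn] := wr j; have wl : (size l < w j)%N.
    by rewrite ltnNge; apply: contra (jl); apply: rl; exact: root_out.
  have := no j; move: wl wn ln; clear; lia.
have := uniq_leq_size uc sub; rewrite size_map size_iota szc; move: ln; clear; lia.
Qed.

Lemma placed_step s w l : in_range n.+1 w ->
  (s -> forall k, (k <= n.+1)%N -> (k <= #|[set i | (w i <= k)%N]%SET|)%N) ->
  placed s w l -> (size l <= n)%N -> exists x, placed s w (rcons l x).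
Proof.
move=> wr wp pl ln; have [ul lr rl pre pos_lt] := pl.
have idx x j : j \in l -> index j (rcons l x) = index j l.
  by move=> jl; rewrite -cats1 index_cat jl.
have idxx x : x \notin l -> index x (rcons l x) = size l.
  by move=> xl; rewrite -cats1 index_cat (negbTE xl) /= eqxx addn0.
have idxlt x i j : j \in l -> (index i l < index j l)%N ->
    (index i (rcons l x) < index j (rcons l x))%N.
  move=> jl lt; have il : i \in l.
    by rewrite -index_mem (ltn_trans lt) // index_mem.
  by rewrite !idx.
have [/existsP[j0 /eqP wj0]|/existsPn no] := boolP [exists j, w j == (size l).+1].
  have [x /rootbP xr wx] := arcs_root_exists w j0; rewrite wj0 in wx.
  have xl : x \notin l.
    apply/negP => xl; have := lr _ xl xr; rewrite wx => -[e].
    by move: xl; rewrite -index_mem -e ltnn.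
  exists x; split.
  - by rewrite rcons_uniq xl.
  - move=> j; rewrite mem_rcons inE => /predU1P[->|jl] jr; first by rewrite idxx.
    by rewrite idx // lr.
  - move=> j jr; rewrite size_rcons mem_rcons inE leq_eqVlt => /orP[/eqP wj|].
      by rewrite (arcs_root_uniq (rootbP _ _ jr) (rootbP _ _ xr)) ?eqxx // wj wx.
    by rewrite ltnS => /(rl _ jr) ->; rewrite orbT.
  - rewrite filter_rcons xr /=; apply: prefix_trans pre _; exact: successors_rcons.
  - move=> st i j ij; rewrite mem_rcons inE => /predU1P[e|jl].
      by move/rootbP: xr => /(_ i); rewrite -e ij.
    by apply: idxlt => //; exact: pos_lt.
have lt := placed_size wr wp pl ln no.
set k := size _ in lt; pose x := nth ord0 (successors s w l) k.
have xs : x \in successors s w l by rewrite mem_nth.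
have [i0 i0s i0x] : exists2 i, i \in source s l & (i, x) \in arcs w.
  by move: xs; rewrite mem_pmap => /mapP[i il /esym/succ_ofP]; exists i.
have xr : ~~ rootb w x by apply/forallPn; exists i0; rewrite negbK.
have fE : [seq j <- l | ~~ rootb w j] = take k (successors s w l).
  by move/prefixP: pre => [t ->]; rewrite take_size_cat.
have xl : x \notin l.
  apply/negP => xl; have : x \in [seq j <- l | ~~ rootb w j] by rewrite mem_filter xr.
  rewrite fE => /(nthP ord0)[m]; rewrite size_takel ?(ltnW lt) // => mk.
  rewrite nth_take // => /eqP; rewrite nth_uniq ?successors_uniq //; last exact: ltn_trans lt.
  by rewrite (ltn_eqF mk).
exists x; split.
- by rewrite rcons_uniq xl.
- move=> j; rewrite mem_rcons inE => /predU1P[->|jl] jr; first by rewrite jr in xr.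
  by rewrite idx // lr.
- move=> j jr; rewrite size_rcons mem_rcons inE leq_eqVlt (negbTE (no j)) ltnS.
  by move=> /(rl _ jr) ->; rewrite orbT.
- rewrite filter_rcons xr fE -take_nth //; apply: prefix_trans (successors_rcons s w l x).
  exact: prefix_take.
- move=> st i j ij; rewrite mem_rcons inE => /predU1P[e|jl].
    subst j; have [_ _ /(_ _ _ _ ij i0x) ->] := arcs_chains w.
    by move: i0s; rewrite /source st => il; rewrite idxx // idx // index_mem.
  by apply: idxlt => //; exact: pos_lt.
Qed.

Lemma word_of_exists s w : in_range n.+1 w ->
  (s -> forall k, (k <= n.+1)%N -> (k <= #|[set i | (w i <= k)%N]%SET|)%N) ->
  (~~ s -> rook_word w) ->
  exists p, okdiag s K p (arcs w) /\ word_of p (arcs w) w.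
Proof.
move=> wr wp wrook.
have build m : (m <= n.+1)%N -> exists2 l, placed s w l & size l = m.
  elim: m => [|m IH] mn.
    exists [::] => //; split=> //; last exact: prefix0s.
    by move=> j _; rewrite leqn0 => /eqP wj; have := wr j; rewrite wj.
  have [l pl lm] := IH (ltnW mn); have [|x plx] := placed_step wr wp pl.
    by rewrite lm -ltnS.
  by exists (rcons l x) => //; rewrite size_rcons lm.
case: {build} (build _ (leqnn _)) => l pl ls.
have [ul lr rl pre plt] := pl.
have [p pE] := perm_of_seq ul ls.
have inl j : j \in l by rewrite -index_mem -pE ls.
have rootE j : rootb w j -> w j = (pos p j).+1 by rewrite pE; exact: lr.
have [alt afun ainj] := arcs_chains w.
exists p; split; last first.
  by split=> [i j /arcs_eq //|j /rootbP]; exact: rootE.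
split.
- by apply/fintype.subsetP => -[i j] /alt; rewrite inE.
- move=> i j ij; rewrite /active /hd; case: s wp wrook pl pre plt => [|] wp wrook pl pre plt.
    by rewrite !pE; apply: plt.
  have /rootbP r0 : is_root (arcs w) ord0 by move=> k; apply/negP => /alt.
  (* If [j] stood at or before label 1, the rook condition would provide a root at the position of
     [j], but [j] has a predecessor. *)
  rewrite ltnNge; apply/negP => le; have [_ rk] := wrook isT.
  have [|k wk] := rk (pos p j).+1; first by rewrite rootE.
  have [r /rootbP rr wrk] := arcs_root_exists w k.
  have rj : r = j.
    by apply: (@pos_inj _ p); apply/val_inj; move: (rootE _ rr); rewrite wrk wk => -[].
  by move/rootbP: rr => /(_ i); rewrite rj ij.
move=> i j i' j' ij ij' ki kj.
have nr u v : (u, v) \in arcs w -> ~~ rootb w v.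
  by move=> uv; apply/forallPn; exists u; rewrite negbK.
(* The keys order the source list, hence also the list of successors. *)
have le1 : (index j' (successors s w l) <= index j (successors s w l))%N.
  apply: (index_pmap_le (@succ_of_inj w)); try by apply/succ_ofP; eassumption.
  by move: ki; rewrite /key /source; case: (s); rewrite ?pE ?index_enum_ord.
have idx v : ~~ rootb w v ->
    index v (successors s w l) = index v [seq j <- l | ~~ rootb w j].
  by move=> vr; move/prefixP: pre => [t ->]; rewrite index_cat mem_filter vr inl.
(* The non-roots appear in [l] in the order of the list of successors, so positions give the reverse
   inequality. *)
have le2 : (index j (successors s w l) <= index j' (successors s w l))%N.
  rewrite !idx ?(nr _ _ ij) ?(nr _ _ ij') //.
  by apply: index_filter_le; [exact: nr ij|rewrite -!pE].
have e : index j (successors s w l) = index j' (successors s w l).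
  by apply/eqP; rewrite eqn_leq le1 le2.
have mem u v : (u, v) \in arcs w -> v \in successors s w l.
  move=> uv; move/prefixP: pre => [t ->].
  by rewrite mem_cat mem_filter (nr _ _ uv) inl.
have jj : j = j' by rewrite -(nth_index ord0 (mem _ _ ij)) e nth_index // (mem _ _ ij').
by subst j'; rewrite (ainj _ _ _ ij ij').
Qed.
End ArcDiagrams.

(** * Rotation of words *)

Section CycleLemma.
Variable n : nat.
Notation word := {ffun 'I_n.+1 -> nat}.
Notation rot k := (iter k (@shift_word n)).
Implicit Types (v w : word) (k : nat).

Lemma in_range_rot k w : in_range n.+2 w -> in_range n.+2 (rot k w).
Proof.
by move=> wr; elim: k => // k IH i; rewrite iterS ffunE /= ltn_mod.
Qed.

Lemma in_rangeS w : in_range n.+1 w -> in_range n.+2 w.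
Proof. by move=> wr i; have /andP[-> h] := wr i; exact: leq_trans h (leqnSn _). Qed.

Lemma rotE k w i : in_range n.+2 w -> rot k w i = (((w i).-1 + k) %% n.+2).+1.
Proof.
move=> wr; elim: k => [|k IH]; last first.
  by rewrite iterS ffunE IH -[X in (X %% _)%N]addn1 modnDml addn1 addnS.
have /andP[w1 wn] := wr i.
by rewrite addn0 modn_small prednK.
Qed.

Lemma rot_small k w i : in_range n.+2 w -> (k < n.+2)%N ->
  rot k w i = if (w i + k <= n.+2)%N then (w i + k)%N else (w i + k - n.+2)%N.
Proof.
move=> wr kn; rewrite rotE //; have /andP[w1 wn] := wr i.
case: leqP => h.
  by rewrite modn_small; move: w1 h kn; clear; lia.
have -> : ((w i).-1 + k = (w i + k - n.+3) + n.+2)%N by move: w1 h; clear; lia.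
rewrite modnDr modn_small; move: w1 wn h kn; clear; lia.
Qed.

Lemma rot_mod k w : in_range n.+2 w -> rot k w = rot (k %% n.+2) w.
Proof. by move=> wr; apply/ffunP => i; rewrite !rotE // modnDmr. Qed.

Lemma rot_id k w : in_range n.+2 w -> (k %% n.+2 = 0)%N -> rot k w = w.
Proof. by move=> wr e; rewrite rot_mod // e. Qed.

Lemma rot_inv k w v : in_range n.+2 w -> v = rot k w -> exists l, w = rot l v.
Proof.
move=> wr ->; exists (n.+2 - k %% n.+2)%N; rewrite -iterD rot_id //.
rewrite -modnDmr subnK ?modnn //; exact/ltnW/ltn_pmod.
Qed.

Lemma rot_inj k w i j : in_range n.+2 w -> (rot k w i == rot k w j) = (w i == w j).
Proof.
move=> wr; have [l e] := rot_inv wr (erefl (rot k w)).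
apply/eqP/eqP => h; last by rewrite !rotE // h.
have wr' := in_range_rot k wr; move: (rotE l i wr') (rotE l j wr').
by rewrite -e h => -> ->.
Qed.

Lemma arcs_rot k w : in_range n.+2 w -> arcs (rot k w) = arcs w.
Proof.
move=> wr; apply/finset.setP => -[i j]; rewrite !in_arcs rot_inj //.
by congr [&& _, _ & _]; apply: eq_forallb => l; rewrite rot_inj.
Qed.

Lemma parking_rot_uniq k v : parking v -> parking (rot k v) -> rot k v = v.
Proof.
move=> /parkingP[vr vP]; have vr' := in_rangeS vr; rewrite rot_mod //.
set l := (k %% n.+2)%N; have ln : (l < n.+2)%N by exact: ltn_pmod.
have [->//|l0] := posnP l; move=> /parkingP[_ /(_ l ln) h].
have := vP (n.+2 - l)%N; have le : (n.+2 - l <= n.+1)%N by move: l0; clear; lia.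
move=> /(_ le) h'; exfalso.
(* The letters at most [l] after the rotation are those above [n.+2 - l]
   before it, so the two parking conditions force [n.+2] letters in total. *)
have := cardsC [set i | (v i <= n.+2 - l)%N]%SET; rewrite card_ord.
have -> : (~: [set i | (v i <= n.+2 - l)%N])%SET = [set i | (rot l v i <= l)%N]%SET.
  apply/finset.setP => i; rewrite !inE rot_small //; have /andP[v1 v2] := vr i.
  by move: v1 v2 l0 ln; clear; case: ifP; lia.
by move: h h' ln; clear; lia.
Qed.

(** Rotate by [l] with [0 < l < n.+2]. If the first letter does not wrap, it ends at least at [l],
    yet [l] could only come from a letter 0 or [n.+2]. If it wraps, the letter [n.+2 - l] occurs in
    [v] and is rotated to [n.+2]. *)
Lemma rook_rot_uniq k v : rook_word v -> rook_word (rot k v) -> rot k v = v.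
Proof.
move=> [vr vP]; have vr' := in_rangeS vr; rewrite rot_mod //.
set l := (k %% n.+2)%N; have ln : (l < n.+2)%N by exact: ltn_pmod.
have [->//|l0] := posnP l; move=> [wr wP]; exfalso.
have [h|h] := leqP (v ord0 + l) n.+2.
  have [|i] := wP l; first by rewrite l0 rot_small // h leq_addl.
  rewrite rot_small //; have /andP[] := vr i; move: l0; clear; case: ifP; lia.
have [|i vi] := vP (n.+2 - l)%N; first by move: ln h; clear; lia.
have := wr i; rewrite rot_small // vi subnK ?leqnn; last exact: ltnW.
by rewrite ltnn andbF.
Qed.

Lemma parking_rot_exists w : in_range n.+2 w -> exists k, parking (rot k w).
Proof.
(* A rotation with minimal letter sum is a parking function: if fewer than [l]
   letters were at most [l], subtracting [l] would decrease the sum. *)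
move=> wr; pose f (k : 'I_n.+2) := (\sum_i rot k w i)%N.
have [k _ kmin] := @arg_minnP _ ord0 xpredT f isT; exists k.
set v := rot k w; have vr : in_range n.+2 v by exact: in_range_rot.
have vP l : (l <= n.+1)%N -> (l <= #|[set i | (v i <= l)%N]%SET|)%N.
  move=> ln; rewrite leqNgt; apply/negP => lt.
  set c := #|_| in lt.
  have l0 : (0 < l)%N by exact: leq_ltn_trans lt.
  have kl : (n.+2 - l < n.+2)%N by move: l0 ln; clear; lia.
  have := kmin (Ordinal (ltn_pmod (n.+2 - l + k) (ltn0Sn n.+1))) isT.
  rewrite /f /= -rot_mod // iterD -/v leqNgt => /negP; apply.
  (* Rotating by [n.+2 - l] subtracts [l] from each letter and adds [n.+2] to those at most [l]. *)
  have : (\sum_i (rot (n.+2 - l) v i + l) = \sum_i (v i + (v i <= l) * n.+2))%N.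
    apply: eq_bigr => i _; rewrite rot_small //; have /andP[v1 v2] := vr i.
    by move: v1 v2 l0 ln; clear; case: ifP; case: leqP; lia.
  rewrite !big_split /= sum_nat_const card_ord -big_distrl /=.
  have -> : (\sum_i ((v i <= l) : nat) = c)%N.
    by rewrite /c -sum1dep_card [RHS]big_mkcond /=; apply: eq_bigr => i _; case: ifP.
  have ll : (n.+1 * l + l <= n.+1 * n.+1 + n.+1)%N.
    by rewrite addnC -mulSn addnC -mulSn leq_mul2l ln orbT.
  have : (c * n.+2 <= l.-1 * n.+2)%N by rewrite leq_mul2r; move: lt; clear; lia.
  move: l0 ln; clear; nia.
apply/parkingP; split=> // i; have /andP[v1 _] := vr i; rewrite v1 /=.
(* The case [l = n.+1] of [vP] says that no letter is [n.+2]. *)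
have /eqP := finset.eqEcard [set i | (v i <= n.+1)%N]%SET [set: 'I_n.+1]%SET.
rewrite finset.subsetT cardsT card_ord vP //= => /eqP/eqP/finset.setP/(_ i).
by rewrite !inE.
Qed.

Lemma rook_rot_exists w : in_range n.+2 w -> exists k, rook_word (rot k w).
Proof.
move=> wr.
(* There are [n.+1] letters and [n.+2] possible values. *)
have [z zw wz] : exists2 z : nat, (1 <= z <= n.+2)%N & forall i, w i != z.
  apply: contrapT => h.
  have sub : {subset iota 1 n.+2 <= codom w}.
    move=> z; rewrite mem_iota add1n ltnS => zr; apply: contrapT => zc; apply: h.
    exists z => // i; apply/eqP => e; apply: zc; rewrite -e; exact: codom_f.
  have := uniq_leq_size (iota_uniq 1 n.+2) sub.
  by rewrite size_codom card_ord size_iota ltnn.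
(* Among the rotations avoiding the letter [n.+2], one with minimal first letter
   is a rook word: a letter missing below it could be rotated to [n.+2]. *)
pose P (k : 'I_n.+2) := [forall i, (rot k w i <= n.+1)%N].
have /andP[z1 zn] := zw.
have zlt : (n.+2 - z < n.+2)%N by move: z1 zn; clear; lia.
have P0 : P (Ordinal zlt).
  apply/forallP => i; rewrite /= rot_small //; have /andP[w1 wn] := wr i.
  have := wz i; move: z1 zn w1 wn; clear; case: ifP; lia.
have [k /forallP Pk kmin] := @arg_minnP _ _ P (fun k : 'I_n.+2 => rot k w ord0) P0.
exists k; set v := rot k w in Pk kmin *; have vr : in_range n.+2 v by exact: in_range_rot.
split=> [i|l /andP[l1 lv]]; first by have /andP[-> _] := vr i; rewrite Pk.
apply: contrapT => no; have ne i : v i != l.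
  by apply/eqP => e; apply: no; exists i.
have lt : (n.+2 - l < n.+2)%N by have := Pk ord0; move: l1 lv; clear; lia.
have lE : rot (Ordinal (ltn_pmod (n.+2 - l + k) (ltn0Sn n.+1))) w = rot (n.+2 - l) v.
  by rewrite /= -rot_mod // iterD.
have := kmin (Ordinal (ltn_pmod (n.+2 - l + k) (ltn0Sn n.+1))); rewrite /P lE.
have -> : [forall i, (rot (n.+2 - l) v i <= n.+1)%N].
  apply/forallP => i; rewrite rot_small //; have /andP[v1 vn] := vr i.
  have := ne i; have := Pk i; move: l1 lt v1 vn; clear; case: ifP; lia.
move=> /(_ isT); rewrite rot_small //; have := ne ord0; have := Pk ord0.
move: l1 lv lt; clear; case: ifP; lia.
Qed.

Lemma betaP w : rook_word w -> parking (beta w) /\ exists k, beta w = rot k w.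
Proof.
move=> [wr _]; have [k pk] := parking_rot_exists (in_rangeS wr).
rewrite /beta; apply: (xgetPex w (P := [set v | parking v /\ exists k, v = rot k w])).
by exists (rot k w); split=> //; exists k.
Qed.

Lemma parking_in_range w : parking w -> in_range n.+2 w.
Proof. by case=> wr _; exact: in_rangeS. Qed.

Lemma beta_inj w w' : rook_word w -> rook_word w' -> beta w = beta w' -> w = w'.
Proof.
move=> rw rw' e; have [_ [k bk]] := betaP rw; have [_ [k' bk']] := betaP rw'.
have [l wl] := rot_inv (in_rangeS rw.1) bk.
have wE : w = rot (l + k') w' by rewrite iterD -bk' -e.
by rewrite wE; apply: rook_rot_uniq => //; rewrite -wE.
Qed.

Lemma beta_rot k v w : parking v -> rook_word w -> w = rot k v -> beta w = v.
Proof.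
move=> pv rw wE; have [pb [l bl]] := betaP rw.
have bE : beta w = rot (l + k) v by rewrite bl wE iterD.
by rewrite bE; apply: parking_rot_uniq => //; rewrite -bE.
Qed.

Lemma beta_surj v : parking v -> exists2 w, rook_word w & beta w = v.
Proof.
move=> pv; have [k rk] := rook_rot_exists (parking_in_range pv).
by exists (rot k v) => //; exact: beta_rot erefl.
Qed.

Lemma beta_id w : rook_word w -> parking w -> beta w = w.
Proof. by move=> rw pw; apply: (@beta_rot 0). Qed.

Lemma beta_rook_id w : rook_word w -> rook_word (beta w) -> beta w = w.
Proof.
by move=> rw rb; have [_ [k bk]] := betaP rw; rewrite bk; apply: rook_rot_uniq => //; rewrite -bk.
Qed.

Lemma arcs_beta w : rook_word w -> arcs (beta w) = arcs w.
Proof.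
by move=> rw; have [_ [k ->]] := betaP rw; rewrite arcs_rot //; exact: in_rangeS rw.1.
Qed.
End CycleLemma.

(** * The bijection *)

Section DiagramWords.
Variables (R : realType) (n : nat).
Notation lab := 'I_n.+1.
Notation vec := 'rV[R]_n.+1.
Notation K := (complete_graph n).
Implicit Types (s : bool) (p q : 'S_n.+1) (i j a b : lab) (C D : set vec)
  (G M : {set lab * lab}) (w : {ffun lab -> nat}).

Lemma complete_is_graph : is_graph K.
Proof. by move=> i j; rewrite inE. Qed.

(** On diagrams, the identification with regions over [K] is just the inclusion of [M] in [G], since
    activity and comparability do not involve the graph. *)
Lemma okdiag_complete s G p M : is_graph G ->
  okdiag s G p M <-> okdiag s K p M /\ M \subset G.
Proof.
move=> hG; have GK : G \subset K.
  by apply/fintype.subsetP => -[i j] /hG; rewrite inE.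
split=> [[MG ac anti]|[[_ ac anti] MG]]; last by split.
by split=> //; split=> //; apply: fintype.subset_trans GK.
Qed.

Lemma region_permE s G C p M : has_diag s G C p M -> region_perm C = p.
Proof.
move=> [reg Cp _ _]; have [x Cx] := region_nonempty reg.
apply: xget_unique => [y /Cp //|q qC].
by apply: (@ordered_inj _ _ _ _ x); [exact: qC|exact: Cp].
Qed.

Lemma dominantE s G C p M : has_diag s G C p M -> dominant C <-> p = 1%g.
Proof.
move=> [reg Cp _ _]; have [x Cx] := region_nonempty reg.
split=> [dC|p1 y /Cp py i j ij]; last by have := py _ _ ij; rewrite p1 !perm1.
apply: (ordered_inj (Cp _ Cx)) => a b ab; rewrite !perm1; exact: dC.
Qed.

Definition pos_rel p M a b := (p a, p b) \in M.

Lemma pos_rel_connect s p M a b : okdiag s K p M ->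
  connect (fun a b => `[< pos_rel p M a b \/ pos_rel p M b a >]) a b =
  connect (pos_rel p M) a b || connect (pos_rel p M) b a.
Proof.
move=> /okdiag_chains [_ Mfun Minj]; rewrite -connect_sym_closure.
- apply: eq_connect => c d; apply/asboolP/orP => -[h|h]; by [left|right].
- by move=> c d e h h'; apply: (@perm_inj _ p); exact: Mfun h h'.
- by move=> c d e h h'; apply: (@perm_inj _ p); exact: Minj h h'.
Qed.

Lemma mem_pblock_generated (P : lab -> lab -> Prop) a b :
  (b \in finset.pblock (generated_partition P) a) =
  connect (fun i j => `[< P i j \/ P j i >]) a b.
Proof.
have sym : connect_sym (fun i j : lab => `[< P i j \/ P j i >]).
  by apply: sym_connect_sym => i j; apply/asboolP/asboolP => -[]; [right|left|right|left].
rewrite pblock_equivalence_partition ?finset.in_setT // => i j k _ _ _; split=> //.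
by move=> ij; exact: (same_connect sym ij).
Qed.

Lemma block_min_eq (P : lab -> lab -> Prop) a b :
  connect (fun i j => `[< P i j \/ P j i >]) a b ->
  block_min (generated_partition P) a = block_min (generated_partition P) b.
Proof.
move=> ab.
have sym : connect_sym (fun i j : lab => `[< P i j \/ P j i >]).
  by apply: sym_connect_sym => i j; apply/asboolP/asboolP => -[]; [right|left|right|left].
have mem c : (c \in finset.pblock (generated_partition P) a) =
    (c \in finset.pblock (generated_partition P) b).
  by rewrite !mem_pblock_generated; exact: (same_connect sym ab).
have self c : c \in finset.pblock (generated_partition P) c.
  by rewrite mem_pblock_generated connect0.
rewrite /block_min; case: arg_minnP => // c ca cmin; case: arg_minnP => // d db dmin.
by apply/val_inj/eqP; rewrite eqn_leq cmin ?mem // dmin // -mem.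
Qed.

Lemma shi_diagramE G C p M : has_diag true G C p M ->
  shi_diagram C = (p, generated_partition (pos_rel p M)).
Proof.
move=> dC; rewrite /shi_diagram (region_permE dC); case: dC => _ _ _ ceil.
congr (_, generated_partition _); apply/funext => a; apply/funext => b.
by apply/propext; exact: ceil.
Qed.

(** Positions increase along Shi arcs, so the least position in a block is that of the root of its
    chain. *)
Lemma park_word_of G C p M : okdiag true K p M -> has_diag true G C p M ->
  word_of p M (park_word C).
Proof.
move=> ok dC; rewrite /park_word (shi_diagramE dC).
have [_ ac _] := ok; split=> [i j ij|j jr]; rewrite !ffunE.
  congr (val _).+1; apply: block_min_eq; rewrite (pos_rel_connect _ _ ok).
  apply/orP; right; apply: connect1.
  by rewrite /pos_rel -!/(pos _ _) !posK.
congr _.+1; rewrite -/(pos p j) /block_min; case: arg_minnP => [|c].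
  by rewrite mem_pblock_generated connect0.
rewrite mem_pblock_generated (pos_rel_connect _ _ ok) => /orP[] cj /(_ (pos p j)).
  rewrite mem_pblock_generated connect0 => /(_ isT) cle.
  apply/eqP; rewrite eqn_leq cle /=; move: cj => /connectP[l].
  elim: l (pos p j) {cle} => [|d l IH] a /=; first by move=> _ ->.
  move=> /andP[ad dl] cE; have := ac _ _ ad; rewrite /active /hd !permposK => lt.
  by apply: leq_trans (ltnW lt) (IH _ dl cE).
case: (connect_last cj) => [->//|[d _ dj]] _.
by move: dj; rewrite /pos_rel posK (negbTE (jr _)).
Qed.

Lemma word_of_uniq p M w w' : chains M -> word_of p M w -> word_of p M w' -> w = w'.
Proof.
move=> chM wM wM'; apply/ffunP => j; have [r rr rj] := root_exists j chM.
rewrite (word_of_connect wM rj) (word_of_connect wM' rj).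
by case: wM wM' => _ -> // [_ ->].
Qed.

(** The parking word depends on the Shi diagram only, and by [word_of_inj] it determines the order
    and the arcs. *)
Lemma shi_diagram_inj G G' C D p M p' M' : is_graph G -> is_graph G' ->
  okdiag true G p M -> has_diag true G C p M ->
  okdiag true G' p' M' -> has_diag true G' D p' M' ->
  shi_diagram C = shi_diagram D -> p = p' /\ M = M'.
Proof.
move=> hG hG' /(okdiag_complete _ _ _ hG)[ok _] dC /(okdiag_complete _ _ _ hG')[ok' _] dD e.
apply: (word_of_inj ok ok' (park_word_of ok dC)).
have -> : park_word C = park_word D by rewrite /park_word e.
exact: park_word_of dD.
Qed.

Lemma ish_diagram_root G C p M j : has_diag false G C p M -> is_root M (p j) ->
  (ish_diagram C).2 j = 0%N.
Proof.
move=> dC; rewrite /ish_diagram (region_permE dC) /= ffunE => jr.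
case: dC => _ _ _ ceil; apply: xgetPN => -[|k] [] //= kn.
by move/(ceil (Ordinal kn)); apply/negP; exact: jr.
Qed.

Lemma ish_diagram_arc G C p M i j : chains M -> has_diag false G C p M ->
  (i, p j) \in M -> (ish_diagram C).2 j = i.+1.
Proof.
move=> [_ _ Minj] dC; rewrite /ish_diagram (region_permE dC) /= ffunE => ij.
case: dC => _ _ _ ceil; apply: xget_unique.
  by split; [rewrite ltnS; exact: ltn_ord|apply/(ceil i)].
move=> [|k] [] //= kn /(ceil (Ordinal kn)) kj.
by rewrite (Minj _ _ _ ij kj).
Qed.

Lemma ish_diagramP G C p M i j : chains M -> has_diag false G C p M ->
  (i, j) \in M <-> (ish_diagram C).2 (pos p j) = i.+1.
Proof.
move=> chM dC; rewrite -{1}(posK p j); split; first exact: (ish_diagram_arc chM dC).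
have [/existsP[k kj]|/existsPn jr] := boolP [exists k, (k, p (pos p j)) \in M].
  by rewrite (ish_diagram_arc chM dC kj) => -[/val_inj <-].
by rewrite (ish_diagram_root dC).
Qed.

Lemma ish_diagram_inj G G' C D p M p' M' : is_graph G -> is_graph G' ->
  okdiag false G p M -> has_diag false G C p M ->
  okdiag false G' p' M' -> has_diag false G' D p' M' ->
  ish_diagram C = ish_diagram D -> p = p' /\ M = M'.
Proof.
move=> hG hG' /(okdiag_complete _ _ _ hG)[/okdiag_chains chM _] dC.
move=> /(okdiag_complete _ _ _ hG')[/okdiag_chains chM' _] dD e.
have pp : p = p'.
  by move: (congr1 fst e); rewrite /= (region_permE dC) (region_permE dD).
subst p'; split => //; apply/finset.setP => -[i j].
apply/idP/idP => [/(ish_diagramP _ _ chM dC)|/(ish_diagramP _ _ chM' dD)] h.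
  by apply/(ish_diagramP _ _ chM' dD); rewrite -e.
by apply/(ish_diagramP _ _ chM dC); rewrite e.
Qed.

Lemma rook_row_rho G C p M i : has_diag false G C p M ->
  rook_row (rho C) i = let e := (ish_diagram C).2 (pos p i) in
    if e == 0%N then (pos p i).+1 else (n.+1 + e)%N.
Proof.
move=> dC; have := region_permE dC; rewrite /rook_row /rho.
case dE : (ish_diagram C) => [p' eps] pE /=.
have e : p' = p by rewrite -pE -[p']/((p', eps).1) -dE.
subst p'; apply: xget_unique; first by exists i.
by move=> r [i' [<- ->]].
Qed.

(** Each letter is computed from the accumulator, which survives as a prefix of the final list
    [W]. *)
Lemma foldl_laser (r : lab -> nat) (ws : seq nat) (l : seq lab) k :
  let W := foldl (fun ws i => rcons ws
    (if (r i <= n.+1)%N then r i else nth 0%N ws (r i - n.+1).-1)) ws l in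
  (size W = size ws + size l)%N /\ take (size ws) W = ws /\
  ((k < size l)%N -> let i := nth ord0 l k in
    nth 0%N W (size ws + k) =
    if (r i <= n.+1)%N then r i else nth 0%N (take (size ws + k) W) (r i - n.+1).-1).
Proof.
elim: l ws k => [|i l IH] ws k /=; first by rewrite addn0 take_size.
set ws' := rcons ws _; have [sW [tW _]] := IH ws' 0%N.
move: sW tW; set W := foldl _ _ _ => sW tW.
have szws : size ws' = (size ws).+1 by rewrite size_rcons.
have tW' : take (size ws) W = ws.
  by rewrite -(cat_take_drop (size ws') W) tW /ws' cat_rcons take_size_cat.
split; first by rewrite sW szws addSnnS.
split=> //; case: k => [_|k] /=.
  rewrite addn0 tW' -(nth_take 0%N (n0 := size ws')) ?szws // -szws tW.
  by rewrite nth_rcons ltnn eqxx.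
rewrite ltnS => kl; have [_ [_ /(_ kl)]] := IH ws' k.
by rewrite szws addSnnS.
Qed.

(** A rook above the bar records an arc into its column, and its laser copies the letter of the
    predecessor; the rook of a root lies below the bar, in the row of its position. *)
Lemma lambda_word_of G C p M : okdiag false K p M -> has_diag false G C p M ->
  word_of p M (lambda (rho C)).
Proof.
move=> ok dC; have chM := okdiag_chains ok.
pose r := rook_row (rho C).
pose W := foldl (fun ws i => rcons ws
  (if (r i <= n.+1)%N then r i else nth 0%N ws (r i - n.+1).-1)) [::] (enum lab).
have lamE i : lambda (rho C) i = nth 0%N W i by rewrite ffunE.
have WE i : nth 0%N W i =
    if (r i <= n.+1)%N then r i else nth 0%N (take i W) (r i - n.+1).-1.
  have [_ [_]] := foldl_laser r [::] (enum lab) i.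
  by rewrite size_enum_ord ltn_ord add0n nth_ord_enum => /(_ isT).
have [Mlt _ _] := chM.
split=> [k j kj|j jr]; rewrite !lamE.
  rewrite WE /r (rook_row_rho _ dC) /= ((ish_diagramP _ _ chM dC).1 kj) /=.
  have -> : (n.+1 + k.+1 <= n.+1)%N = false.
    by apply/negbTE; rewrite -ltnNge addnS ltnS leq_addr.
  by rewrite addKn nth_take // Mlt.
rewrite WE /r (rook_row_rho _ dC) /= (ish_diagram_root dC) ?posK //= ltn_ord.
by [].
Qed.

(** [realize_diag] provides a region to choose, and [ish_diagram_inj] shows that any choice has the
    same order and arcs. *)
Lemma ish_to_completeP G C p M : is_graph G -> okdiag false G p M ->
  has_diag false G C p M -> has_diag false K (ish_to_complete G C) p M.
Proof.
move=> hG ok dC; have hK := complete_is_graph.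
have [okK MG] := (okdiag_complete _ _ _ hG).1 ok.
have [D dD] := realize_diag R hK okK.
have [_ Dreg eqD] : ish_identified G C (ish_to_complete G C).
  apply: (xgetPex set0 (P := [set D | ish_identified G C D])).
  exists D; split; [by case: dC|by case: dD|].
  have h p' M' (E : set vec) G' : has_diag false G' E p' M' -> (ish_diagram E).1 = p'.
    by move=> dE; rewrite -(region_permE dE).
  rewrite [LHS]surjective_pairing [RHS]surjective_pairing (h _ _ _ _ dC) (h _ _ _ _ dD).
  congr (_, _); apply/ffunP => j; have chM := okdiag_chains okK.
  have [/existsP[k kj]|/existsPn jr] := boolP [exists k, (k, p j) \in M].
    by rewrite (ish_diagram_arc chM dC kj) (ish_diagram_arc chM dD kj).
  by rewrite (ish_diagram_root dC) // (ish_diagram_root dD).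
have [p' [M' [ok' dD']]] := has_diag_exists (s := false) hK Dreg.
by have [-> ->] := ish_diagram_inj hG hK ok dC ok' dD' eqD.
Qed.

Lemma shi_of_completeP G D p M : is_graph G -> okdiag true G p M ->
  has_diag true K D p M -> has_diag true G (shi_of_complete G D) p M.
Proof.
move=> hG ok dD; have hK := complete_is_graph.
have [okK MG] := (okdiag_complete _ _ _ hG).1 ok.
have [C dC] := realize_diag R hG ok.
have [Creg _ eqC] : shi_identified G (shi_of_complete G D) D.
  apply: (xgetPex set0 (P := [set C | shi_identified G C D])).
  exists C; split; [by case: dC|by case: dD|].
  by rewrite (shi_diagramE dC) (shi_diagramE dD).
have [p' [M' [ok' dC']]] := has_diag_exists (s := true) hG Creg.
by have [<- <-] := shi_diagram_inj hG hK ok' dC' okK dD eqC.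
Qed.

Lemma omegaP w : parking w ->
  exists p, [/\ okdiag true K p (arcs w), has_diag true K (@omega R n w) p (arcs w)
    & word_of p (arcs w) w].
Proof.
move=> /parkingP[wr wp]; have hK := complete_is_graph.
have [//|p [ok wE]] := @word_of_exists n true w wr (fun _ => wp).
have [D dD] := realize_diag R hK ok.
have [reg pw] : regions (@Shi R n K) (@omega R n w) /\ park_word (@omega R n w) = w.
  apply: (xgetPex set0 (P := [set C | regions (@Shi R n K) C /\ park_word C = w])).
  exists D; split; first by case: dD.
  exact: word_of_uniq (okdiag_chains ok) (park_word_of ok dD) wE.
have [p' [M' [ok' d']]] := has_diag_exists (s := true) hK reg.
have w' := park_word_of ok' d'; rewrite pw in w'.
by have [e1 e2] := word_of_inj ok ok' wE w'; exists p; split=> //; rewrite e2 e1.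
Qed.

(** The labels in the first [k] positions have letters at most [k]. *)
Lemma shi_word_parking p M w : okdiag true K p M -> word_of p M w -> parking w.
Proof.
move=> ok wM; apply/parkingP; split=> [i|k kn].
  exact: word_of_range (okdiag_chains ok) wM.
rewrite -[X in (X <= _)%N](card_ord_lt kn) -(card_imset _ (@perm_inj _ p)).
apply/subset_leq_card/fintype.subsetP => i /imsetP[a]; rewrite !inE => ak ->.
by apply: leq_trans (word_of_shi_le _ ok wM) _; rewrite permposK.
Qed.

(** Follows one region through the composition: the order changes from [p] to [q], while [M] is kept
    because rotation preserves arcs. *)
Lemma ish_to_shiP G C : is_graph G -> regions (@Ish R n G) C ->
  exists p q M w,
  [/\ okdiag false G p M, has_diag false G C p M, word_of p M w & rook_word w] /\
  [/\ okdiag true G q M, has_diag true G (ish_to_shi G C) q M & word_of q M (beta w)].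
Proof.
move=> hG reg; have [p [M [ok dC]]] := has_diag_exists (s := false) hG reg.
have [okK MG] := (okdiag_complete _ _ _ hG).1 ok.
have dK := ish_to_completeP hG ok dC.
have wM := lambda_word_of okK dK; set w := lambda _ in wM.
have rw := word_of_rook okK wM; have [pb _] := betaP rw.
have [q [okq dq wq]] := omegaP pb.
have ME : arcs (beta w) = M.
  by rewrite (arcs_beta rw); exact: arcs_word_of (okdiag_chains okK) wM.
rewrite ME in okq dq wq; exists p, q, M, w; split=> //.
have okG : okdiag true G q M by apply/(okdiag_complete _ _ _ hG).
by split=> //; exact: shi_of_completeP.
Qed.

(** For the identity order positions are labels, so the two keys agree and every pair of [K] is
    active in both cases. *)
Lemma trivial_okdiag M : okdiag false K 1%g M <-> okdiag true K 1%g M.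
Proof.
have pos1 i : pos (1%g : 'S_n.+1) i = i by rewrite /pos invg1 perm1.
have act s i j : (i, j) \in K -> active s (1%g : 'S_n.+1) i j.
  rewrite inE /active /hd !pos1 /=; case: s => // ij.
  exact: leq_ltn_trans ij.
split=> -[/fintype.subsetP MK _ anti]; split; try exact/fintype.subsetP.
- by move=> i j /MK; exact: act.
- by move=> i j i' j' ij ij' k l; apply: anti => //; move: k; rewrite /key !pos1.
- by move=> i j /MK; exact: act.
- by move=> i j i' j' ij ij' k l; apply: anti => //; move: k; rewrite /key !pos1.
Qed.
End DiagramWords.

Theorem theorem6p1 (R : realType) (n : nat) (G : {set 'I_n.+1 * 'I_n.+1})
    (hG : is_graph G) :
  [/\ set_bij (regions (@Ish R n G)) (regions (@Shi R n G)) (ish_to_shi G),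
      forall C : set 'rV[R]_n.+1, regions (@Ish R n G) C ->
        shi_ceiling_partition (ish_to_shi G C) = ish_ceiling_partition C
    & forall C : set 'rV[R]_n.+1, regions (@Ish R n G) C ->
        (dominant C <-> dominant (ish_to_shi G C))].
Proof.
split; first split.
- move=> C /(ish_to_shiP hG)[p [q [M [w [_ [_ dq _]]]]]].
  by case: dq.
(* Injectivity: equal images have the same word [beta w], hence the same rook word and the same Ish
   diagram. *)
- move=> C C'; rewrite !inE => /(ish_to_shiP hG)[p [q [M [w [[okp dp wp rw] [okq dq wq]]]]]].
  move=> /(ish_to_shiP hG)[p' [q' [M' [w' [[okp' dp' wp' rw'] [okq' dq' wq']]]]]] e.
  rewrite e in dq; have [eq eM] := has_diag_uniq dq dq'; subst q' M'.
  have [okpK _] := (okdiag_complete _ _ _ hG).1 okp.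
  have [okpK' _] := (okdiag_complete _ _ _ hG).1 okp'.
  have bw : beta w = beta w' by exact: word_of_uniq (okdiag_chains okpK) wq wq'.
  have ww := beta_inj rw rw' bw; subst w'.
  have [ep _] := word_of_inj okpK okpK' wp wp'; subst p'.
  exact: has_diag_inj hG dp dp'.
(* Surjectivity: the parking word of [E] is rotated to a rook word, whose Ish diagram has the same
   arcs and is therefore realized over [G]. *)
- move=> E Ereg; have [q [M [okq dq]]] := has_diag_exists (s := true) hG Ereg.
  have [okqK MG] := (okdiag_complete _ _ _ hG).1 okq.
  have wq := park_word_of okqK dq; set v := park_word E in wq.
  have pv := shi_word_parking okqK wq.
  have [w rw bw] := beta_surj pv.
  have [//|p [okp wp]] := @word_of_exists n false w rw.1 _ (fun _ => rw).
  have ME : arcs w = M.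
    by rewrite -(arcs_beta rw) bw; exact: arcs_word_of (okdiag_chains okqK) wq.
  rewrite ME in okp wp.
  have okpG : okdiag false G p M by apply/(okdiag_complete _ _ _ hG).
  have [C dC] := realize_diag R hG okpG; have Creg : regions (@Ish R n G) C by case: dC.
  exists C => //.
  have [p' [q' [M' [w' [[_ dp' wp' rw'] [okq' dq' wq']]]]]] := ish_to_shiP hG Creg.
  have [ep eM] := has_diag_uniq dC dp'; subst p' M'.
  have ww := word_of_uniq (okdiag_chains okp) wp wp'; subst w'.
  have [okqK' _] := (okdiag_complete _ _ _ hG).1 okq'.
  rewrite bw in wq'; have [eq _] := word_of_inj okqK okqK' wq wq'; subst q'.
  exact: has_diag_inj hG dq' dq.
(* The ceilings of both regions correspond to the same set [M]. *)
- move=> C /(ish_to_shiP hG)[p [q [M [w [[_ [_ _ _ cp] _ _] [_ [_ _ _ cq] _]]]]]].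
  rewrite /shi_ceiling_partition /ish_ceiling_partition; congr generated_partition.
  apply/funext => i; apply/funext => j; apply/propext.
  exact: iff_trans (cq i j) (iff_sym (cp i j)).
move=> C /(ish_to_shiP hG)[p [q [M [w [[okp dp wp rw] [okq dq wq]]]]]].
have [okpK _] := (okdiag_complete _ _ _ hG).1 okp.
have [okqK _] := (okdiag_complete _ _ _ hG).1 okq.
rewrite (dominantE dp) (dominantE dq); split=> [p1|q1].
  (* [(1, M)] is also a Shi diagram with word [w], so [w] is a parking function fixed by [beta], and
     [q] is the identity. *)
  subst p; have ok1 := (trivial_okdiag _).1 okpK.
  have bw := beta_id rw (shi_word_parking ok1 wp).
  by rewrite bw in wq; have [] := word_of_inj okqK ok1 wq wp.
(* Conversely, [beta w] is the word of an Ish diagram, hence a rook word in the orbit of [w]. *)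
subst q; have ok1 := (trivial_okdiag _).2 okqK.
have bw := beta_rook_id rw (word_of_rook ok1 wq).
by rewrite bw in wq; have [] := word_of_inj okpK ok1 wp wq.
Qed.
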